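(* Let $d\ge2$ and let $\mu$ be a positive Borel measure on $\mathbb{R}^d$ with $\mu(E)=1$, where $E$ is its support, and assume there exist $0<\alpha\le d$ and $c_0>0$ with $\mu(B(x,r))\le c_0r^\alpha$ for every open ball $B(x,r)$. Assume $E\subseteq B(0,r_0)$. Then there exists $c>0$ such that for every $N$ and every point distribution $\mathcal{P}_N=\{z_1,\dots,z_N\}\subset B(0,r_0)$, $$\left\{\int_0^{+\infty}\int_{\Sigma_{d-1}}\left|\mathcal{D}_N(\Pi(\rho,\Theta))\right|^2d\Theta\,d\rho\right\}^{1/2}\ge c\,N^{1/2-1/(2\alpha)}.$$
   Context: $\Sigma_{d-1}$ is the unit sphere in $\mathbb{R}^d$ with its normalized surface measure $d\Theta$. For $\rho\in\mathbb{R}$, $\Theta\in\Sigma_{d-1}$, $\Pi(\rho,\Theta)=\{x\in\mathbb{R}^d: x\cdot\Theta>\rho\}$, and $\mathcal{D}_N(\Pi(\rho,\Theta))=\sum_{j=1}^N\chi_{\Pi(\rho,\Theta)}(z_j)-N\mu(\Pi(\rho,\Theta))$. *)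

(* Defs.v *)
From HB Require Import structures.
From mathcomp Require Import all_boot all_order all_algebra.
From mathcomp Require Import all_classical all_reals all_analysis.
Set Implicit Arguments. Unset Strict Implicit. Unset Printing Implicit Defensive.
Import Order.TTheory GRing.Theory Num.Theory.
Import numFieldNormedType.Exports.
Local Open Scope classical_set_scope.
Local Open Scope ring_scope.

Section Defs.
Variable R : realType.

Definition dotp (d : nat) (x y : 'rV[R]_d) : R := \sum_(i < d) x ord0 i * y ord0 i.
Definition enorm (d : nat) (x : 'rV[R]_d) : R := Num.sqrt (dotp x x).

Definition eball (d : nat) (x : 'rV[R]_d) (r : R) : set 'rV[R]_d :=
  [set y | enorm (y - x) < r].

Definition borelRd (d : nat) := g_sigma_algebraType (@open 'rV[R]_d).

Definition msupport (d : nat) (mu : {measure set (borelRd d) -> \bar R})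
  : set 'rV[R]_d :=
  [set x | forall r : R, 0 < r -> (0 < mu (eball x r))%E].

Definition halfspace (d : nat) (rho : R) (th : 'rV[R]_d) : set 'rV[R]_d :=
  [set x | rho < dotp x th].

Definition discr (d N : nat) (mu : {measure set (borelRd d) -> \bar R})
  (z : 'I_N -> 'rV[R]_d) (rho : R) (th : 'rV[R]_d) : R :=
  \sum_(j < N) (if rho < dotp (z j) th then 1 else 0)
  - N%:R * fine (mu (halfspace rho th)).

Fixpoint iint (n : nat) (f : (nat -> R) -> \bar R) : \bar R :=
  match n with
  | 0 => f (fun _ => 0)
  | n'.+1 => (\int[@lebesgue_measure R]_(t in [set: R])
               iint n' (fun x => f (fun i => if i == n' then t else x i)))%E
  end.

Definition intRd (d : nat) (g : 'rV[R]_d -> \bar R) : \bar R :=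
  iint d (fun x => g (\row_(i < d) x i)).

(** Integral against the normalized surface measure of the unit sphere:
    int_{Sigma} g dTheta = (1/|B|) int_{B(0,1)} g(x/|x|) dx. *)
Definition sphere_avg (d : nat) (g : 'rV[R]_d -> \bar R) : \bar R :=
  (intRd (fun x => if (enorm x < 1)%R then g (((enorm x)^-1 *: x)%R) else 0%E)
   * ((fine (intRd (fun x : 'rV[R]_d => if (enorm x < 1)%R then 1%E else 0%E)))^-1)%:E)%E.

Definition L2discr (d N : nat) (mu : {measure set (borelRd d) -> \bar R})
  (z : 'I_N -> 'rV[R]_d) : \bar R :=
  (\int[@lebesgue_measure R]_(rho in [set rho : R | (0 <= rho)%R])
     sphere_avg (fun th => ((discr mu z rho th) ^+ 2)%R%:E))%E.

End Defs.

(* Main.v *)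
(** Write F(rho, w) for the discrepancy of the half-space {x . w > rho}; it is
    homogeneous in (rho, w), so the average over the sphere becomes an integral
    over w in a cube, and the rho-integral for fixed w is the squared L^2 norm of
    a function of one variable.  Its Fourier coefficients of order m are, up to
    1/m, the exponential sums sum_j e(m z_j . w) - N mu^(m w).  Bessel's inequality
    with the frequencies M <= m < 2M, tested against the part coming from the
    points only, bounds the rho-integral below by
      sum_m 1/(pi m^2)
        (sum_(i,j) cos(m (z_i - z_j).w) - 2 N sum_j int cos(m (z_j - y).w) dmu(y)).
    Integrating against a product of triangular windows in w turns the cosines
    into values of a product Fejer kernel Phi >= 0.  The terms i <> j are dropped,
    the diagonal contributes N Phi(0), and tiling space by cubes of side 1/m shows
    that int Phi(m (z_j - y)) dmu(y) is O(m^-alpha).  The diagonal therefore wins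
    when M is a large multiple of N^(1/alpha), and the sum over m is of order
    N / M ~ N^(1 - 1/alpha). *)
Require Import Defs.
From HB Require Import structures.
From mathcomp Require Import all_boot all_order all_algebra.
From mathcomp Require Import all_classical all_reals all_analysis.
From mathcomp Require Import measurable_realfun ring lra.
Import Order.TTheory GRing.Theory Num.Theory.
Import numFieldNormedType.Exports.
Local Open Scope classical_set_scope.
Local Open Scope ring_scope.
Set Implicit Arguments. Unset Strict Implicit. Unset Printing Implicit Defensive.

(** * Integration preliminaries *)

(** Testing against the points alone costs nothing essential: the full Bessel bound also contains
    N^2 |mu^(m w)|^2, which is nonnegative, and giving it up avoids a double integral against mu.
    Three constraints shape the rest. Fourier series in one variable need all projections x . w
    inside one period, so the window in w lives in a cube so small that |x . w| < 1 < pi. Only rho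
    >= 0 is integrated, that is half a period, on which shifted sines of different frequencies are
    not orthogonal; the directions w and -w are therefore treated together, and the reflected half
    restores orthogonality. Finally, directional integrals are iterated integrals with values in the
    extended reals, where nonnegative integrands can be handled by Tonelli alone; each cosine is
    replaced by 1 + cos, and the added constants cancel at the end. The cutoff M is dictated by the
    comparison of the cross term, of order N^2 M^-alpha, with the diagonal, of order N. *)

Lemma ftc_cc (R : realType) (f F : R -> R) (a b : R) : a <= b ->
  (forall x, is_derive x (1 : R) F (f x)) -> continuous f ->
  (\int[@lebesgue_measure R]_(x in `[a, b]) (f x)%:E = (F b - F a)%:E)%E.
Proof.
rewrite le_eqVlt => /predU1P[<-|ab] dF cf.
  by rewrite set_itv1 integral_set1 subrr.
have cF : continuous F.
  by move=> x; apply/differentiable_continuous/derivable1_diffP; have [] := dF x.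
rewrite (@continuous_FTC2 _ f F)//.
- exact: continuous_subspaceT.
- split.
  + by move=> x _; have [] := dF x.
  + exact/cvg_at_right_filter/cF.
  + exact/cvg_at_left_filter/cF.
- by move=> x _; rewrite derive1E; have [_ ->] := dF x.
Qed.

Lemma Rftc_cc (R : realType) (f F : R -> R) (a b : R) : a <= b ->
  (forall x, is_derive x (1 : R) F (f x)) -> continuous f ->
  \int[@lebesgue_measure R]_(x in `[a, b]) f x = F b - F a.
Proof. by move=> ab dF cf; rewrite /Rintegral (ftc_cc ab dF cf). Qed.

(** * Bounded measurable functions *)

Section bounded_measurable.
Context d (T : measurableType d) (R : realType).
Implicit Types (f g : T -> R).

(** This class is stable under the operations in use and integrable on every measurable set of
    finite measure, so linearity, monotonicity and Fubini need no separate integrability proof. *)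
Definition bdmeas f :=
  measurable_fun [set: T] f /\ exists M, forall x, `|f x| <= M.

Lemma bdmeas_cst (c : R) : bdmeas (fun=> c).
Proof. by split; [exact: measurable_cst | exists `|c|]. Qed.

Lemma bdmeasD f g : bdmeas f -> bdmeas g -> bdmeas (fun x => f x + g x).
Proof.
move=> [mf [M fM]] [mg [K gK]]; split; first exact: measurable_funD.
by exists (M + K) => x; rewrite (le_trans (ler_normD _ _))// lerD.
Qed.

Lemma bdmeasM f g : bdmeas f -> bdmeas g -> bdmeas (fun x => f x * g x).
Proof.
move=> [mf [M fM]] [mg [K gK]]; split; first exact: measurable_funM.
by exists (M * K) => x; rewrite normrM ler_pM.
Qed.

Lemma bdmeasZ (c : R) f : bdmeas f -> bdmeas (fun x => c * f x).
Proof. by move=> ?; apply: bdmeasM => //; exact: bdmeas_cst. Qed.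

Lemma bdmeasB f g : bdmeas f -> bdmeas g -> bdmeas (fun x => f x - g x).
Proof.
move=> bf bg; rewrite (_ : (fun _ => _) = fun x => f x + -1 * g x); last first.
  by apply/funext => x; rewrite mulN1r.
exact/bdmeasD/bdmeasZ.
Qed.

Lemma bdmeas_sum (I : Type) (s : seq I) (F : I -> T -> R) :
  (forall i, bdmeas (F i)) -> bdmeas (fun x => \sum_(i <- s) F i x).
Proof.
move=> bF; elim: s => [|i s IH].
  under eq_fun do rewrite big_nil; exact: bdmeas_cst.
by under eq_fun do rewrite big_cons; exact: bdmeasD.
Qed.

Lemma bdmeas_ltr f g : measurable_fun setT f -> measurable_fun setT g ->
  bdmeas (fun x => if f x < g x then 1 else 0).
Proof.
move=> mf mg; split.
  apply: measurable_fun_ifT; first exact: measurable_fun_ltr.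
  - exact: measurable_cst.
  - exact: measurable_cst.
by exists 1 => x; case: ifP; rewrite ?normr1 ?normr0.
Qed.

Lemma bdmeas_cos f : measurable_fun setT f -> bdmeas (fun x => cos (f x)).
Proof.
move=> mf; split; last by exists 1 => x; exact: cos_max.
apply: (measurableT_comp _ mf); apply: continuous_measurable_fun; exact: continuous_cos.
Qed.

Lemma bdmeas_sin f : measurable_fun setT f -> bdmeas (fun x => sin (f x)).
Proof.
move=> mf; split; last by exists 1 => x; exact: sin_max.
apply: (measurableT_comp _ mf); apply: continuous_measurable_fun; exact: continuous_sin.
Qed.

Section integral.
Variables (mu : {measure set T -> \bar R}) (D : set T).
Hypotheses (mD : measurable D) (Doo : (mu D < +oo)%E).

Lemma bdmeas_integrable f : bdmeas f -> mu.-integrable D (EFin \o f).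
Proof.
move=> [mf [M fM]]; apply: measurable_bounded_integrable => //.
  exact: measurable_funTS.
exists M; split; first exact: num_real.
by move=> x Mx y _ /=; rewrite (le_trans (fM y))// ltW.
Qed.

Lemma RintD f g : bdmeas f -> bdmeas g ->
  \int[mu]_(x in D) (f x + g x) =
  \int[mu]_(x in D) f x + \int[mu]_(x in D) g x.
Proof. by move=> bf bg; rewrite RintegralD//; exact: bdmeas_integrable. Qed.

Lemma RintB f g : bdmeas f -> bdmeas g ->
  \int[mu]_(x in D) (f x - g x) =
  \int[mu]_(x in D) f x - \int[mu]_(x in D) g x.
Proof. by move=> bf bg; rewrite RintegralB//; exact: bdmeas_integrable. Qed.

Lemma RintZ c f : bdmeas f ->
  \int[mu]_(x in D) (c * f x) = c * \int[mu]_(x in D) f x.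
Proof. by move=> bf; rewrite RintegralZl//; exact: bdmeas_integrable. Qed.

Lemma Rint_sum (I : Type) (s : seq I) (F : I -> T -> R) :
  (forall i, bdmeas (F i)) ->
  \int[mu]_(x in D) (\sum_(i <- s) F i x) =
  \sum_(i <- s) \int[mu]_(x in D) F i x.
Proof.
move=> bF; elim: s => [|i s IH].
  under eq_Rintegral do rewrite big_nil.
  by rewrite big_nil Rintegral_cst// mul0r.
under eq_Rintegral do rewrite big_cons.
rewrite big_cons RintD ?IH//; exact: bdmeas_sum.
Qed.

Lemma le_Rint f g : bdmeas f -> bdmeas g -> (forall x, D x -> f x <= g x) ->
  \int[mu]_(x in D) f x <= \int[mu]_(x in D) g x.
Proof. by move=> bf bg fg; apply: le_Rintegral => //; exact: bdmeas_integrable. Qed.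

Lemma Rint_EFin f : bdmeas f ->
  ((\int[mu]_(x in D) f x)%:E = \int[mu]_(x in D) (f x)%:E)%E.
Proof.
by move=> bf; rewrite /Rintegral fineK//; apply: integrable_fin_num => //;
  exact: bdmeas_integrable.
Qed.

End integral.
End bounded_measurable.

Lemma bdmeas_comp d d' (S : measurableType d) (T : measurableType d') (R : realType)
  (f : T -> R) (u : S -> T) : bdmeas f -> measurable_fun setT u ->
  bdmeas (fun s => f (u s)).
Proof.
move=> [mf [M fM]] mu; split; last by exists M => s.
exact: measurableT_comp.
Qed.

Section fubini_bounded.
Context d1 d2 (T1 : measurableType d1) (T2 : measurableType d2) (R : realType).
Variables (m1 : {sigma_finite_measure set T1 -> \bar R}) (D : set T1).
Variables (P : probability T2 R).
Hypotheses (mD : measurable D) (Doo : (m1 D < +oo)%E).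

Lemma Fubini_bdmeas (f : T1 * T2 -> R) : bdmeas f ->
  \int[m1]_(x in D) \int[P]_y f (x, y) = \int[P]_y \int[m1]_(x in D) f (x, y).
Proof.
move=> bf; have [mf [M fM]] := bf.
have bf1 x : bdmeas (fun y => f (x, y)).
  by apply: (bdmeas_comp bf); exact: pair1_measurable.
have bf2 y : bdmeas (fun x => f (x, y)).
  by apply: (bdmeas_comp bf); exact: pair2_measurable.
have PT : (P setT < +oo)%E by rewrite probability_setT ltry.
(* The set [D] enters through its indicator, so that Fubini applies on the whole product; the
   dominating function [M * \1_D] is integrable because [D] has finite measure. *)
pose g z := ((\1_D z.1 * f z)%:E : \bar R).
have mg : measurable_fun setT g.
  apply/measurable_EFinP; apply: measurable_funM => //.
  by apply: (measurableT_comp (measurable_indic mD)); exact: measurable_fst.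
have gM z : (`|g z| <= (\1_D z.1 * M)%:E)%E.
  by rewrite /g lee_fin normrM ler_pM// ger0_norm// ?indicE.
have ig : (m1 \x P)%E.-integrable setT g.
  apply/integrable12ltyP => //.
  apply: (@le_lt_trans _ _ (\int[m1]_x (M%:E * (\1_D x)%:E))%E).
    apply: ge0_le_integral => //.
    - by move=> x _; exact: integral_ge0.
    - apply: (measurable_fun_fubini_tonelli_F (fun z => `|g z|%E)) => //.
      exact: measurableT_comp.
    - apply: measurable_funeM; exact/measurable_EFinP.
    move=> x _; apply: (@le_trans _ _ (\int[P]_y (\1_D x * M)%:E)%E).
      apply: ge0_le_integral => //.
      apply: measurableT_comp => //; apply: (measurableT_comp mg).
        exact: pair1_measurable.
    rewrite integral_cst// [X in (_ * X <= _)%E](_ : _ = 1%E); last exact: probability_setT.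
    by rewrite mule1 EFinM muleC.
  rewrite ge0_integralZl//; last 2 first.
  - exact/measurable_EFinP.
  - by rewrite lee_fin (le_trans _ (fM (point, point))).
  rewrite integral_indic// setIT lte_mul_pinfty//.
  by rewrite lee_fin (le_trans _ (fM (point, point))).
have := Fubini ig; rewrite /Rintegral => E.
congr fine; transitivity (\int[m1]_x \int[P]_y g (x, y))%E.
  rewrite integral_mkcond; apply: eq_integral => x _.
  rewrite patchE /g /= indicE; case: ifP => xD /=.
    rewrite -/(Rintegral _ _ _). rewrite Rint_EFin//; apply: eq_integral => y _. by rewrite mul1r.
  by rewrite integral0_eq// => y _; rewrite mul0r.
rewrite E; apply: eq_integral => y _.
transitivity (\int[m1]_(x in D) (f (x, y))%:E)%E; last by rewrite -Rint_EFin.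
rewrite [RHS]integral_mkcond; apply: eq_integral => x _.
by rewrite patchE /g /= indicE; case: ifP => _ /=; rewrite ?mul1r ?mul0r.
Qed.

End fubini_bounded.

(** * Trigonometric integrals *)

Lemma sin_natpi (R : realType) (n : nat) : sin (n%:R * pi : R) = 0.
Proof.
elim: n => [|n IH]; first by rewrite mul0r sin0.
by rewrite -natr1 mulrDl mul1r sinDpi IH oppr0.
Qed.

Lemma continuous_sinL (R : realType) (p q : R) :
  continuous (fun x : R => sin (p + q * x)).
Proof.
move=> x; apply: (@continuous_comp _ _ _ (fun x => p + q * x) sin).
  apply: cvgD; first exact: cvg_cst.
  by apply: cvgM; [exact: cvg_cst|exact: cvg_id].
exact: continuous_sin.
Qed.

Lemma continuous_cosL (R : realType) (p q : R) :
  continuous (fun x : R => cos (p + q * x)).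
Proof.
move=> x; apply: (@continuous_comp _ _ _ (fun x => p + q * x) cos).
  apply: cvgD; first exact: cvg_cst.
  by apply: cvgM; [exact: cvg_cst|exact: cvg_id].
exact: continuous_cos.
Qed.

Lemma is_derive_cosL (R : realType) (p q x : R) :
  is_derive x (1 : R) (fun x : R => cos (p + q * x)) (- (q * sin (p + q * x))).
Proof.
have h : is_derive x (1 : R) (fun x : R => p + q * x) q.
  by apply: is_derive_eq; rewrite add0r mul1r /GRing.scale /= mulr1.
apply: (@is_derive_eq _ _ _ (cos \o (fun x => p + q * x)) x 1 _ _ (is_derive1_comp _ h)).
by rewrite /= mulNr mulrC.
Qed.

Lemma is_derive_sinL (R : realType) (p q x : R) :
  is_derive x (1 : R) (fun x : R => sin (p + q * x)) (q * cos (p + q * x)).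
Proof.
have h : is_derive x (1 : R) (fun x : R => p + q * x) q.
  by apply: is_derive_eq; rewrite add0r mul1r /GRing.scale /= mulr1.
apply: (@is_derive_eq _ _ _ (sin \o (fun x => p + q * x)) x 1 _ _ (is_derive1_comp _ h)).
by rewrite /= mulrC.
Qed.

Lemma Rint_sinL (R : realType) (p q c : R) : 0 <= c -> q != 0 ->
  \int[@lebesgue_measure R]_(x in `[0, c]) sin (p + q * x) =
  (cos p - cos (p + q * c)) / q.
Proof.
move=> c0 q0.
have dF x : is_derive x (1 : R) (fun x => - q^-1 * cos (p + q * x)) (sin (p + q * x)).
  have h := is_derive_cosL p q x.
  apply: is_derive_eq; rewrite /GRing.scale /=; by field.
rewrite (Rftc_cc c0 dF (@continuous_sinL _ p q)).
by rewrite mulr0 addr0; field.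
Qed.

Lemma Rint_cosL (R : realType) (p q c : R) : 0 <= c -> q != 0 ->
  \int[@lebesgue_measure R]_(x in `[0, c]) cos (p + q * x) =
  (sin (p + q * c) - sin p) / q.
Proof.
move=> c0 q0.
have dF x : is_derive x (1 : R) (fun x => q^-1 * sin (p + q * x)) (cos (p + q * x)).
  have h := is_derive_sinL p q x.
  apply: is_derive_eq; rewrite /GRing.scale /=; by field.
rewrite (Rftc_cc c0 dF (@continuous_cosL _ p q)).
by rewrite mulr0 addr0; field.
Qed.

(** * One-dimensional discrepancy *)

Section half_line_discrepancy.
Context (R : realType) (dT : measure_display) (T : measurableType dT) (P : probability T R).

Definition hdisc (N : nat) (a : 'I_N -> R) (U : T -> R) (t : R) : R :=
  \sum_(j < N) (if t < a j then 1 else 0)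
  - N%:R * fine (P [set y | t < U y]).

Let lam := @lebesgue_measure R.

Lemma Rint_prob_cst (c : R) : \int[P]_y c = c.
Proof.
by rewrite Rintegral_cst// [X in fine X](_ : _ = 1%E) ?mulr1//; exact: probability_setT.
Qed.

(** With points and measure under one integral over [P], a pairing with [hdisc] can be exchanged by
    Fubini and computed for each fixed [y]. *)
Lemma hdisc_mean (N : nat) (a : 'I_N -> R) (U : T -> R) (t : R) :
  measurable_fun setT U ->
  hdisc a U t = \int[P]_y (\sum_(j < N) (if t < a j then 1 else 0)
                           - N%:R * (if t < U y then 1 else 0)).
Proof.
move=> mU; have PT : (P setT < +oo)%E by rewrite probability_setT ltry.
have b1 : bdmeas (fun y => if t < U y then 1 else 0 : R).
  by apply: bdmeas_ltr => //; exact: measurable_cst.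
have mS : measurable [set y | t < U y].
  have -> : [set y | t < U y] = U @^-1` `]t, +oo[.
    by apply/seteqP; split => y /=; rewrite in_itv/= andbT.
  by rewrite -[X in measurable X]setTI; exact: mU.
rewrite RintB//; [|exact: bdmeas_cst|exact: bdmeasZ].
rewrite RintZ// Rint_prob_cst; congr (_ - _ * _).
rewrite /Rintegral -[LHS]/(fine _) -(setIT [set y | _]) -integral_indic//.
congr fine; apply: eq_integral => y _; rewrite indicE.
by case: ifP => h; [rewrite mem_set|rewrite memNset//= h].
Qed.

Lemma bdmeas_prob d (S : measurableType d) (V : S * T -> R) :
  measurable_fun setT V -> bdmeas (fun s => fine (P [set y | 0 < V (s, y)])).
Proof.
move=> mV.
have mS : measurable [set z | 0 < V z].
  have -> : [set z | 0 < V z] = V @^-1` `]0, +oo[.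
    by apply/seteqP; split => y /=; rewrite in_itv/= andbT.
  by rewrite -[X in measurable X]setTI; exact: mV.
have e s : [set y | 0 < V (s, y)] = xsection [set z | 0 < V z] s.
  by apply/seteqP; split => y; rewrite /xsection/= inE.
under eq_fun do rewrite e.
split.
  apply: measurableT_comp => //; exact: measurable_fun_xsection.
exists 1 => s; rewrite ger0_norm ?fine_ge0//.
rewrite -(lee_fin _ 1) fineK; first by apply: probability_le1; exact: measurable_xsection.
apply: fin_num_measure; exact: measurable_xsection.
Qed.

End half_line_discrepancy.

(** * Bessel's inequality for the one-dimensional discrepancy *)

Section bessel.
Context (R : realType) (M N : nat) (s : R).
Hypotheses (M0 : (0 < M)%N) (s0 : 0 < s).
Implicit Types (a : 'I_N -> R) (u : R).

Let lam := @lebesgue_measure R.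
Let L := pi / s.

Definition freq (k : 'I_M) : R := (M + k)%:R.

(* The part of the Fourier partial sum of the discrepancy, over the frequencies
   [M <= m < 2M], that comes from the points only; [s] rescales the period. *)
Definition trig a (t : R) : R :=
  \sum_(p : 'I_M * 'I_N)
    (pi * freq p.1)^-1 * sin (freq p.1 * a p.2 + - (freq p.1 * s) * t).

Lemma freq_gt0 k : 0 < freq k.
Proof. by rewrite /freq ltr0n addn_gt0 M0. Qed.

Lemma period_gt0 : 0 < L.
Proof. by rewrite divr_gt0// pi_gt0. Qed.

Lemma measurable_affine (p q : R) : measurable_fun setT (fun x : R => p + q * x).
Proof.
by apply: measurable_funD; [exact: measurable_cst|apply: measurable_funM].
Qed.

Lemma bdmeas_trig a : bdmeas (trig a).
Proof.
apply: bdmeas_sum => p; apply/bdmeasZ/bdmeas_sin; exact: measurable_affine.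
Qed.

Lemma lam_itv_fin (c : R) : (lam `[0%R, c]%classic < +oo)%E.
Proof.
rewrite /lam lebesgue_measure_itv; case: ifP => // _; exact: ltry.
Qed.

Lemma Rint_below (f : R -> R) u : bdmeas f -> u < pi ->
  \int[lam]_(t in `[0, L]) ((if s * t < u then 1 else 0) * f t) =
  if 0 <= u then \int[lam]_(t in `[0, u / s]) f t else 0.
Proof.
move=> bf upi.
have su t : (s * t < u) = (t < u / s) by rewrite ltr_pdivlMr// mulrC.
transitivity (\int[lam]_(t in `[0, L]%classic `&` [set t | t < u / s]) f t).
  rewrite Rintegral_mkcondr; apply: eq_Rintegral => t _.
  rewrite patchE su; case: ifP => h; first by rewrite mem_set ?mul1r.
  by rewrite memNset ?mul0r//= h.
case: ifP => u0.
  rewrite -Rintegral_itv_bndo_bndc.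
    congr (Rintegral _ _ _); apply/seteqP; split => t /=; rewrite !in_itv/=.
      by move=> [/andP[-> _] ->].
    move=> /andP[-> h]; split => //; apply/ltW/(lt_le_trans h).
    by rewrite ler_pM2r ?invr_gt0// ltW.
  apply: bdmeas_integrable => //; apply: le_lt_trans (lam_itv_fin (u / s)).
  apply: le_measure; rewrite ?inE//.
  by apply: subset_itvl; rewrite bnd_simp.
rewrite (_ : _ `&` _ = set0) ?Rintegral_set0//.
rewrite -subset0 => t /=; rewrite in_itv/= => -[/andP[t0 _]].
by rewrite -su => /(le_lt_trans (mulr_ge0 (ltW s0) t0)); rewrite ltNge ltW// ltNge u0.
Qed.

(* The pairing of [trig a] with the step function of a point mass at [u]. *)
Definition corr a u : R :=
  s^-1 * \sum_(p : 'I_M * 'I_N) (pi * freq p.1 ^+ 2)^-1 *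
    (cos (freq p.1 * (a p.2 - u)) - cos (freq p.1 * a p.2)).

Lemma corrNN a u : corr (fun j => - a j) (- u) = corr a u.
Proof.
congr (_ * _); apply: eq_bigr => p _.
by rewrite -opprD !mulrN !cosN.
Qed.

Lemma corr0 a : corr a 0 = 0.
Proof. by rewrite /corr big1 ?mulr0// => p _; rewrite subr0 subrr mulr0. Qed.

Lemma Rint_trig_below a u : 0 <= u -> 
  \int[lam]_(t in `[0, u / s]) trig a t = corr a u.
Proof.
move=> u0; rewrite Rint_sum//; last 2 first.
- exact: lam_itv_fin.
- by move=> p; apply/bdmeasZ/bdmeas_sin; exact: measurable_affine.
rewrite /corr mulr_sumr; apply: eq_bigr => p _.
have fp := freq_gt0 p.1; have := lt0r_neq0 fp; have := lt0r_neq0 s0.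
have := lt0r_neq0 (pi_gt0 R) => pi0 s_neq0 f_neq0.
rewrite RintZ//; last 2 first.
- exact: lam_itv_fin.
- by apply/bdmeas_sin; exact: measurable_affine.
rewrite Rint_sinL; last 2 first.
- by rewrite divr_ge0// ltW.
- by rewrite oppr_eq0 mulf_neq0.
have -> : freq p.1 * a p.2 + - (freq p.1 * s) * (u / s) = freq p.1 * (a p.2 - u).
  by field.
by move: (@pi R) (freq p.1) pi0 f_neq0 {fp} => w f w0 f0; field; rewrite w0 f0.
Qed.

(** For [u] nonzero exactly one of the two steps is active on [0, L], according to the sign of [u],
    and [corrNN] makes both cases agree. The bound [|u| < pi] keeps the jump inside the half
    period. *)
Lemma Rint_corr a u : `|u| < pi ->
  \int[lam]_(t in `[0, L]) ((if s * t < u then 1 else 0) * trig a t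
     + (if s * t < - u then 1 else 0) * trig (fun j => - a j) t) = corr a u.
Proof.
rewrite ltr_norml => /andP[Npiu upi].
have b v b : bdmeas (fun t => (if s * t < v then 1 else 0) * trig b t).
  apply: bdmeasM (bdmeas_trig b); apply: bdmeas_ltr.
    by apply: measurable_funM.
  exact: measurable_cst.
rewrite RintD; [|by []|exact: lam_itv_fin|exact: b|exact: b].
rewrite !Rint_below//; [|exact: bdmeas_trig| by rewrite ltrNl|exact: bdmeas_trig].
have [->|u0] := eqVneq u 0.
  by rewrite oppr0 lexx !Rint_trig_below// corr0 corr0 addr0.
rewrite oppr_ge0; have [h|h] := leP 0 u.
  by rewrite leNgt lt_neqAle eq_sym u0 h/= addr0 Rint_trig_below.
by rewrite ltW// add0r Rint_trig_below ?oppr_ge0 ?corrNN// ltW.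
Qed.

Lemma Rint_cos_period (k : nat) : (0 < k)%N ->
  \int[lam]_(t in `[0, L]) cos (k%:R * s * t) = 0.
Proof.
move=> k0; have k0' : k%:R != 0 :> R by rewrite pnatr_eq0 -lt0n.
have := @Rint_cosL R 0 (k%:R * s) L (ltW period_gt0).
rewrite mulf_neq0// ?lt0r_neq0// => /(_ isT).
under eq_Rintegral do rewrite add0r.
move=> ->; rewrite add0r sin0 subr0 -mulrA /L (mulrCA s) divff ?lt0r_neq0//.
by rewrite mulr1 sin_natpi mul0r.
Qed.

(** Adding the reflected product cancels the part odd in [t]. What is left is a combination of
    cosines of frequencies |k - l| and (M + k) + (M + l), and a cosine of nonzero frequency
    integrates to 0 already over half a period. *)
Lemma Rint_trig_orth (x y : R) (k l : 'I_M) :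
  \int[lam]_(t in `[0, L])
   (sin (freq k * x + - (freq k * s) * t) * sin (freq l * y + - (freq l * s) * t) +
    sin (freq k * - x + - (freq k * s) * t) * sin (freq l * - y + - (freq l * s) * t))
  = if k == l then L * cos (freq k * (x - y)) else 0.
Proof.
(* [i] is |k - l|: one of the two truncated differences is 0. *)
pose i := (k - l + (l - k))%N; pose j := (M + k + (M + l))%N.
have e t : sin (freq k * x + - (freq k * s) * t) * sin (freq l * y + - (freq l * s) * t) +
    sin (freq k * - x + - (freq k * s) * t) * sin (freq l * - y + - (freq l * s) * t)
  = cos (freq k * x - freq l * y) * cos (i%:R * s * t)
    - cos (freq k * x + freq l * y) * cos (j%:R * s * t).
  have -> : cos (i%:R * s * t) = cos (freq k * s * t - freq l * s * t).
    rewrite /i /freq -!mulrBl; case: (leqP l k) => kl.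
      rewrite (eqP (kl : l - k == 0)%N) addn0 natrB//.
      congr (cos (_ * _ * _)); rewrite !natrD; ring.
    have /eqP -> : (k - l == 0)%N by rewrite subn_eq0 ltnW.
    rewrite add0n natrB 1?ltnW// -cosN -!mulNr.
    congr (cos (_ * _ * _)); rewrite !natrD; ring.
  have -> : j%:R * s * t = freq k * s * t + freq l * s * t.
    by rewrite /j natrD !mulrDl.
  rewrite !mulNr !mulrN !sinB !cosB !cosD !sinN !cosN.
  set A := sin (freq k * x); set A' := cos (freq k * x).
  set B := sin (freq l * y); set B' := cos (freq l * y).
  set C := sin (freq k * s * t); set C' := cos (freq k * s * t).
  set D := sin (freq l * s * t); set D' := cos (freq l * s * t).
  ring.
under eq_Rintegral do rewrite e.
have b (c : R) n : bdmeas (fun t : R => c * cos (n%:R * s * t)).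
  by apply/bdmeasZ/bdmeas_cos; apply: measurable_funM.
have fL := lam_itv_fin L.
have Z (c : R) n : \int[lam]_(t in `[0, L]) (c * cos (n%:R * s * t)) =
    c * \int[lam]_(t in `[0, L]) cos (n%:R * s * t).
  by apply: (RintZ _ fL) => //; apply/bdmeas_cos; apply: measurable_funM.
rewrite RintB; [|by []|exact: fL|exact: b|exact: b].
rewrite !Z.
rewrite (@Rint_cos_period j) ?mulr0 ?subr0; last by rewrite /j !addn_gt0 M0.
have [kl|kl] := eqVneq k l.
  rewrite /i -kl subnn addn0.
  under eq_Rintegral do rewrite !mul0r cos0.
  have IL : lam `[0%R, L]%classic = L%:E.
    by rewrite /lam lebesgue_measure_itv /= lte_fin period_gt0 /= sube0.
  rewrite Rintegral_cst// [X in fine X](_ : _ = L%:E)//.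
  by rewrite mul1r mulrC -mulrBr.
rewrite Rint_cos_period ?mulr0// /i addn_gt0 !subn_gt0 -neq_ltn eq_sym; exact: kl.
Qed.

Lemma Rint_trig_sqr a :
  \int[lam]_(t in `[0, L]) (trig a t ^+ 2 + trig (fun j => - a j) t ^+ 2) =
  s^-1 * \sum_(k < M) (pi * freq k ^+ 2)^-1 *
    \sum_(i < N) \sum_(j < N) cos (freq k * (a i - a j)).
Proof.
under eq_Rintegral => t _.
  rewrite !expr2 /trig !big_distrlr/= -big_split/=.
  under eq_bigr do rewrite -big_split/=.
  over.
have bs p : bdmeas (fun t => sin (freq p.1 * a p.2 + - (freq p.1 * s) * t)).
  apply: bdmeas_sin; exact: measurable_affine.
have fL := lam_itv_fin L.
have bb (p q : 'I_M * 'I_N) b : bdmeas (fun t : R =>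
    (pi * freq p.1)^-1 * sin (freq p.1 * b p.2 + - (freq p.1 * s) * t) *
    ((pi * freq q.1)^-1 * sin (freq q.1 * b q.2 + - (freq q.1 * s) * t))).
  by apply: bdmeasM; apply/bdmeasZ/bdmeas_sin; exact: measurable_affine.
have E (p q : 'I_M * 'I_N) : \int[lam]_(t in `[0, L])
    ((pi * freq p.1)^-1 * sin (freq p.1 * a p.2 + - (freq p.1 * s) * t) *
     ((pi * freq q.1)^-1 * sin (freq q.1 * a q.2 + - (freq q.1 * s) * t)) +
     (pi * freq p.1)^-1 * sin (freq p.1 * - a p.2 + - (freq p.1 * s) * t) *
     ((pi * freq q.1)^-1 * sin (freq q.1 * - a q.2 + - (freq q.1 * s) * t))) =
    if p.1 == q.1 then
      s^-1 * ((pi * freq p.1 ^+ 2)^-1 * cos (freq p.1 * (a p.2 - a q.2))) else 0.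
  under eq_Rintegral do rewrite mulrACA [X in _ + X]mulrACA -mulrDr.
  rewrite (RintZ _ fL)//; last first.
    apply: bdmeasD; apply: bdmeasM.
    - exact: bs.
    - exact: bs.
    - by apply: bdmeas_sin; exact: measurable_affine.
    - by apply: bdmeas_sin; exact: measurable_affine.
  rewrite Rint_trig_orth; case: eqP => [<-|_]; last by rewrite mulr0.
  have pi0 := lt0r_neq0 (pi_gt0 R); have f0 := lt0r_neq0 (freq_gt0 p.1).
  have s_neq0 := lt0r_neq0 s0; rewrite /L.
  move: (@pi R) (freq p.1) pi0 f0 => w f w0 f0; field.
  by rewrite f0 w0.
have bD p q := bdmeasD (bb p q a) (bb p q (fun j => - a j)).
rewrite (Rint_sum _ fL)//; last by move=> p; apply: bdmeas_sum => q; exact: bD.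
under eq_bigr => p _.
  rewrite (Rint_sum _ fL)//; last by move=> q; exact: bD.
  under eq_bigr do rewrite E.
  over.
rewrite -(pair_bigA _ (fun k j => \sum_(q : 'I_M * 'I_N) if k == q.1 then
  s^-1 * ((pi * freq k ^+ 2)^-1 * cos (freq k * (a j - a q.2))) else 0))/=.
rewrite mulr_sumr; apply: eq_bigr => k _.
rewrite mulr_sumr mulr_sumr; apply: eq_bigr => j _.
rewrite -(pair_bigA _ (fun l i => if k == l then
  s^-1 * ((pi * freq k ^+ 2)^-1 * cos (freq k * (a j - a i))) else 0))/=.
rewrite (bigD1 k)//= eqxx [X in _ + X]big1 ?addr0; last first.
  by move=> l lk; apply: big1 => i _; rewrite eq_sym (negbTE lk).
by rewrite mulr_sumr mulr_sumr.
Qed.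

End bessel.

(** * Lower bound for the square norm of the one-dimensional discrepancy *)

Section bessel_bound.
Context (R : realType) (dT : measure_display) (T : measurableType dT) (P : probability T R).
Context (M N : nat) (s : R).
Hypotheses (M0 : (0 < M)%N) (s0 : 0 < s).
Implicit Types (a : 'I_N -> R) (U : T -> R).

Let lam := @lebesgue_measure R.
Let L := pi / s.

Lemma bdmeas_hdisc d (S : measurableType d) (a : 'I_N -> S -> R) (U : S * T -> R) (r : S -> R) :
  (forall j, measurable_fun setT (a j)) -> measurable_fun setT U ->
  measurable_fun setT r ->
  bdmeas (fun x => hdisc P (fun j => a j x) (fun y => U (x, y)) (r x)).
Proof.
move=> ma mU mr; apply: bdmeasB; first by apply: bdmeas_sum => j; exact: bdmeas_ltr.
apply: bdmeasZ.
under eq_fun => x.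
  rewrite (_ : [set y | r x < U (x, y)] = [set y | 0 < U (x, y) - r x]); last first.
    by apply/seteqP; split => y /=; rewrite subr_gt0.
  over.
apply: (@bdmeas_prob _ _ _ P _ _ (fun z => U z - r z.1)).
by apply: measurable_funB => //; apply: measurableT_comp => //; exact: measurable_fst.
Qed.

(** The terms [cos (freq k * a j)] of [corr] do not depend on [u], so they cancel: N points and N
    times a probability have equal mass. The remaining weights 1/(pi m^2) are those of the squared
    norm of [trig], which lets the two be subtracted term by term. *)
Lemma sum_corr a U : measurable_fun setT U ->
  \sum_(i < N) corr M s a (a i) - N%:R * \int[P]_y corr M s a (U y) =
  s^-1 * \sum_(k < M) (pi * freq R k ^+ 2)^-1 *
    \sum_(j < N) (\sum_(i < N) cos (freq R k * (a j - a i))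
                  - N%:R * \int[P]_y cos (freq R k * (a j - U y))).
Proof.
move=> mU; have PT : (P setT < +oo)%E by rewrite probability_setT ltry.
have bc (f x : R) : bdmeas (fun y => cos (f * (x - U y))).
  apply: bdmeas_cos; apply: measurable_funM => //.
  by apply: measurable_funB.
have bcc (f x c : R) : bdmeas (fun y => cos (f * (x - U y)) - c).
  by apply: bdmeasB => //; exact: bdmeas_cst.
rewrite (RintZ _ PT)//; last by apply: bdmeas_sum => p; exact: bdmeasZ.
rewrite /corr -mulr_sumr [X in _ - X = _]mulrCA -mulrBr; congr (_ * _).
rewrite exchange_big (Rint_sum _ PT)//=; last by move=> p; exact: bdmeasZ.
rewrite mulr_sumr -sumrB.
under [RHS]eq_bigr do rewrite mulr_sumr.
rewrite pair_bigA/=; apply: eq_bigr => p _.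
rewrite (RintZ _ PT)// -mulr_sumr [X in _ - X = _]mulrCA -mulrBr; congr (_ * _).
rewrite (RintB _ PT)//; last exact: bdmeas_cst.
rewrite Rint_prob_cst sumrB sumr_const card_ord mulrBr -mulr_natl.
ring.
Qed.

(* The two summands are the halves [t >= 0] and [t <= 0] of the same squared
   discrepancy, since the discrepancy of the whole line vanishes. *)
Lemma hdisc_ge a U : measurable_fun setT U ->
  (forall j, `|a j| < pi) -> (forall y, `|U y| < pi) ->
  s^-1 * \sum_(k < M) (pi * freq R k ^+ 2)^-1 *
     (\sum_(i < N) \sum_(j < N) cos (freq R k * (a i - a j)) -
      2 * N%:R * \sum_(j < N) \int[P]_y cos (freq R k * (a j - U y)))
  <= \int[lam]_(t in `[0, L]) (hdisc P a U (s * t) ^+ 2 +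
       hdisc P (fun j => - a j) (fun y => - U y) (s * t) ^+ 2).
Proof.
move=> mU api Upi; have PT : (P setT < +oo)%E by rewrite probability_setT ltry.
have fL := lam_itv_fin L.
have ms : measurable_fun setT (fun t : R => s * t) by apply: measurable_funM.
have bh (b : 'I_N -> R) V : measurable_fun setT V -> bdmeas (fun t => hdisc P b V (s * t)).
  move=> mV; apply: (@bdmeas_hdisc _ (measurableTypeR R) (fun j _ => b j)
    (fun z => V z.2) (fun t => s * t)) => //.
  by apply: measurableT_comp => //; exact: measurable_snd.
have mNU : measurable_fun setT (fun y => - U y) by exact: measurableT_comp.
(* [A] is the discrepancy before averaging over [y]. After Fubini the pairing splits into step
   functions, one per point and one for [U y], each evaluated by [Rint_corr]. *)
pose A (b : 'I_N -> R) V (z : R * T) : R :=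
  \sum_(j < N) (if s * z.1 < b j then 1 else 0)
   - N%:R * (if s * z.1 < V z.2 then 1 else 0).
have bA b V : measurable_fun setT V -> bdmeas (A b V).
  have ms1 : measurable_fun setT (fun z : R * T => s * z.1).
    by apply: (measurableT_comp ms); exact: measurable_fst.
  move=> mV; apply: bdmeasB.
    by apply: bdmeas_sum => j; apply: bdmeas_ltr.
  apply/bdmeasZ/bdmeas_ltr => //.
  by apply: (measurableT_comp mV); exact: measurable_snd.
pose a' j := - a j; pose U' y := - U y.
pose X (z : R * T) := A a U z * trig M s a z.1 + A a' U' z * trig M s a' z.1.
have bX1 b V : measurable_fun setT V -> bdmeas (fun z => A b V z * trig M s b z.1).
  move=> mV; apply: bdmeasM; first exact: bA.
  apply: (bdmeas_comp (bdmeas_trig _ _ _)); exact: measurable_fst.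
have bX : bdmeas X by apply: bdmeasD; exact: bX1.
have XE : \int[lam]_(t in `[0, L]) (hdisc P a U (s * t) * trig M s a t
     + hdisc P a' U' (s * t) * trig M s a' t) =
   \sum_(i < N) corr M s a (a i) - N%:R * \int[P]_y corr M s a (U y).
  transitivity (\int[lam]_(t in `[0, L]) \int[P]_y X (t, y)).
    apply: eq_Rintegral => t _.
    have bAt b V : measurable_fun setT V -> bdmeas (fun y => A b V (t, y)).
      move=> mV; apply: (bdmeas_comp (bA b V mV)); exact: pair1_measurable.
    have bXt b V : measurable_fun setT V ->
        bdmeas (fun y => A b V (t, y) * trig M s b t).
      by move=> mV; apply: bdmeasM; [exact: bAt|exact: bdmeas_cst].
    rewrite (RintD _ PT)//; [|exact: bXt|exact: bXt].
    rewrite /= !RintegralZr//; [|exact/(bdmeas_integrable _ PT)/bAt..].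
    by rewrite !hdisc_mean.
  rewrite (Fubini_bdmeas P _ fL)//.
  transitivity (\int[P]_y (\sum_(i < N) corr M s a (a i) - N%:R * corr M s a (U y))).
    apply: eq_Rintegral => y _.
    pose K (b : 'I_N -> R) (v t : R) : R := (if s * t < v then 1 else 0) * trig M s b t.
    have bK b (v : R) : bdmeas (K b v).
      apply: bdmeasM (bdmeas_trig _ _ _); exact: bdmeas_ltr.
    have KE v : `|v| < pi -> \int[lam]_(t in `[0, L]) (K a v t + K a' (- v) t) = corr M s a v.
      by move=> vpi; rewrite Rint_corr.
    transitivity (\int[lam]_(t in `[0, L])
       (\sum_(i < N) (K a (a i) t + K a' (- a i) t)
        - N%:R * (K a (U y) t + K a' (- U y) t))).
      apply: eq_Rintegral => t _; rewrite /X /A /K /a' /U' /= big_split /= -!mulr_suml.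
      move: (trig M s a t) (trig M s _ t) => h h'.
      move: (\sum_(j < N) _) (\sum_(j < N) _) => p q.
      by case: ifP; case: ifP => _ _; ring.
    have bKK i := bdmeasD (bK a (a i)) (bK a' (- a i)).
    have bKU := bdmeasD (bK a (U y)) (bK a' (- U y)).
    rewrite (RintB _ fL)//; [|exact: bdmeas_sum|exact: bdmeasZ].
    rewrite (Rint_sum _ fL)// (RintZ _ fL)// KE//; congr (_ - _).
    by apply: eq_bigr => i _; rewrite KE.
  have bc : bdmeas (fun y => corr M s a (U y)).
    apply/bdmeasZ/bdmeas_sum => p; apply/bdmeasZ/bdmeasB; last exact: bdmeas_cst.
    by apply: bdmeas_cos; apply: measurable_funM => //; apply: measurable_funB.
  by rewrite (RintB _ PT)//; [rewrite Rint_prob_cst (RintZ _ PT)|exact: bdmeas_cst|exact: bdmeasZ].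
rewrite sum_corr// in XE.
have HE := Rint_trig_sqr M0 s0 a.
have bt (b : 'I_N -> R) : bdmeas (fun t => trig M s b t ^+ 2).
  by under eq_fun do rewrite expr2; apply: bdmeasM; exact: bdmeas_trig.
have bht (b : 'I_N -> R) V : measurable_fun setT V ->
    bdmeas (fun t => hdisc P b V (s * t) * trig M s b t).
  by move=> mV; apply: bdmeasM; [exact: (bh _ _ mV)|exact: bdmeas_trig].
(* Bessel by completing the square: 2 h g - g^2 <= h^2 pointwise, with h the discrepancy and g =
   [trig], on both halves of the period. *)
apply: (@le_trans _ _ (\int[lam]_(t in `[0, L])
   (2 * (hdisc P a U (s * t) * trig M s a t + hdisc P a' U' (s * t) * trig M s a' t)
    - (trig M s a t ^+ 2 + trig M s a' t ^+ 2)))).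
  rewrite (RintB _ fL)//; last 2 first.
  - exact/bdmeasZ/(bdmeasD (bht _ _ mU) (bht _ _ mNU)).
  - exact: (bdmeasD (bt a) (bt a')).
  rewrite (RintZ _ fL)//; last exact: (bdmeasD (bht _ _ mU) (bht _ _ mNU)).
  rewrite XE HE le_eqVlt; apply/orP; left; apply/eqP.
  rewrite [in RHS]mulrCA -[RHS]mulrBr; congr (_ * _).
  rewrite [in RHS]mulr_sumr -[RHS]sumrB; apply: eq_bigr => k _.
  rewrite sumrB -[in RHS]mulr_sumr; ring.
have bh2 (b : 'I_N -> R) V : measurable_fun setT V -> bdmeas (fun t => hdisc P b V (s * t) ^+ 2).
  by move=> mV; under eq_fun do rewrite expr2; apply: bdmeasM; exact: (bh _ _ mV).
apply: (le_Rint _ fL) => //.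
- apply: bdmeasB.
    exact/bdmeasZ/(bdmeasD (bht _ _ mU) (bht _ _ mNU)).
  exact: (bdmeasD (bt a) (bt a')).
- exact: (bdmeasD (bh2 _ _ mU) (bh2 _ _ mNU)).
move=> t _.
move: (hdisc P a U (s * t)) (hdisc P a' U' (s * t)) (trig M s a t) (trig M s a' t) => p q x y.
have := addr_ge0 (sqr_ge0 (p - x)) (sqr_ge0 (q - y)) => h; rewrite -subr_ge0.
by apply: le_trans h _; rewrite le_eqVlt; apply/orP; left; apply/eqP; ring.
Qed.

End bessel_bound.

(** * Iterated integrals *)

Lemma ge0_integral_oppr (R : realType) (f : R -> \bar R) :
  measurable_fun [set: R] f -> (forall t, 0 <= f t)%E ->
  (\int[@lebesgue_measure R]_t f t = \int[@lebesgue_measure R]_t f (- t)%R)%E.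
Proof.
move=> mf f0.
transitivity (\int[pushforward (@lebesgue_measure R) (-%R : _ -> measurableTypeR R)]_t f t)%E.
  by apply: eq_measure_integral => //= A mA _; exact/esym/lebesgue_measureN.
by rewrite ge0_integral_pushforward//= preimage_setT.
Qed.

Section iterated_integral.
Context (R : realType).
Implicit Types (n : nat) (t : R) (x : nat -> R).

Let lam := @lebesgue_measure R.

Definition upd n t x (i : nat) : R := if i == n then t else x i.

(* Joint measurability, tested along all measurable curves: this avoids putting
   a sigma-algebra on [nat -> R] and passes to partially integrated functions. *)
Definition jmeas dS (S : measurableType dS) (f : S -> (nat -> R) -> \bar R) : Prop :=
  forall dU (U : measurableType dU) (u : U -> S) (x : nat -> U -> R),
    measurable_fun setT u -> (forall i, measurable_fun setT (x i)) ->
    measurable_fun setT (fun z => f (u z) (fun i => x i z)).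

Definition nmeas (f : (nat -> R) -> \bar R) : Prop :=
  forall dU (U : measurableType dU) (x : nat -> U -> R),
    (forall i, measurable_fun setT (x i)) ->
    measurable_fun setT (fun z => f (fun i => x i z)).

Lemma jmeas_nmeas dS (S : measurableType dS) f (s : S) : jmeas f -> nmeas (f s).
Proof. by move=> jf dU U x mx; apply: (jf _ U (fun=> s)) => //. Qed.

Lemma measurable_upd dU (U : measurableType dU) n (t : U -> R) (x : nat -> U -> R) i :
  measurable_fun setT t -> (forall i, measurable_fun setT (x i)) ->
  measurable_fun setT (fun z => upd n (t z) (fun j => x j z) i).
Proof. by move=> mt mx; rewrite /upd; case: eqP. Qed.

Lemma jmeas_upd dS (S : measurableType dS) f n : jmeas f ->
  jmeas (fun z : S * R => fun x => f z.1 (upd n z.2 x)).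
Proof.
move=> jf dU U u x mu mx; apply: (jf _ U (fun z => (u z).1)).
  by apply: measurableT_comp mu; exact: measurable_fst.
move=> i; apply: measurable_upd => //.
by apply: measurableT_comp mu; exact: measurable_snd.
Qed.

Lemma nmeas_upd f n : nmeas f -> jmeas (fun t : R => fun x => f (upd n t x)).
Proof. by move=> jf dU U u x mu mx; apply: (jf _ U) => i; exact: measurable_upd. Qed.

Lemma iint_ge0 n f : (forall x, 0 <= f x)%E -> (0 <= iint n f)%E.
Proof.
elim: n f => [|n IH] f f0 /=; first exact: f0.
by apply: integral_ge0 => t _; apply: IH.
Qed.

(** The induction runs over all parameter spaces: the outermost variable joins the parameter [s],
    and Tonelli makes the last partial integral measurable. *)
Lemma measurable_iint n dS (S : measurableType dS) (f : S -> (nat -> R) -> \bar R) :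
  (forall s x, 0 <= f s x)%E -> jmeas f ->
  measurable_fun setT (fun s => iint n (f s)).
Proof.
elim: n dS S f => [|n IH] dS S f f0 jf /=.
  by apply: (jf _ S id (fun _ _ => 0)) => //.
have := IH _ _ (fun z : S * R => fun x => f z.1 (upd n z.2 x)) (fun z x => f0 _ _)
  (jmeas_upd n jf).
move=> /(measurable_fun_fubini_tonelli_F (m2 := lam)); apply => z.
by apply: iint_ge0 => x; exact: f0.
Qed.

Lemma measurable_iint_upd n f : (forall x, 0 <= f x)%E -> nmeas f ->
  measurable_fun setT (fun t : R => iint n (fun x => f (upd n t x))).
Proof.
move=> f0 nf; apply: (measurable_iint n (f := fun t x => f (upd n t x))).
  by move=> t x; exact: f0.
exact: nmeas_upd.
Qed.

Lemma iint_swap n dS (S : measurableType dS) (m : {sigma_finite_measure set S -> \bar R})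
    (f : S -> (nat -> R) -> \bar R) :
  (forall s x, 0 <= f s x)%E -> jmeas f ->
  (\int[m]_s iint n (f s) = iint n (fun x => \int[m]_s f s x))%E.
Proof.
elim: n f => [|n IH] f f0 jf //=.
have mg := measurable_iint n (fun z x => f0 _ _) (jmeas_upd n jf).
have g0 (z : S * R) : (0 <= iint n (fun x => f z.1 (upd n z.2 x)))%E.
  by apply: iint_ge0 => x; exact: f0.
rewrite (@fubini_tonelli _ _ _ _ _ m lam
  (fun z : S * R => iint n (fun x => f z.1 (upd n z.2 x))) mg g0) /=.
apply: eq_integral => t _; rewrite IH// => dU U u x mu mx.
by apply: (jf _ U u) => // i; exact: measurable_upd.
Qed.

Lemma iint0 n : iint n (fun _ : nat -> R => 0%E) = 0%E.
Proof. by elim: n => //= n ->; rewrite integral0. Qed.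

Lemma eq_iint n (f g : (nat -> R) -> \bar R) : f =1 g -> iint n f = iint n g.
Proof. by move=> /funext ->. Qed.

Lemma le_iint n (f g : (nat -> R) -> \bar R) : (forall x, 0 <= f x)%E -> nmeas f -> nmeas g ->
  (forall x, f x <= g x)%E -> (iint n f <= iint n g)%E.
Proof.
elim: n f g => [|n IH] f g f0 nf ng fg /=; first exact: fg.
have g0 x : (0 <= g x)%E by exact: le_trans (fg x).
apply: ge0_le_integral => //.
- by move=> t _; exact: iint_ge0.
- exact: measurable_iint_upd.
- exact: measurable_iint_upd.
move=> t _; apply: IH => //; exact: (jmeas_nmeas _ (nmeas_upd n _)).
Qed.

Lemma iintD n (f g : (nat -> R) -> \bar R) : (forall x, 0 <= f x)%E -> (forall x, 0 <= g x)%E ->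
  nmeas f -> nmeas g ->
  (iint n (fun x => f x + g x) = iint n f + iint n g)%E.
Proof.
elim: n f g => [|n IH] f g f0 g0 nf ng //=.
rewrite -ge0_integralD//.
- apply: eq_integral => t _; apply: IH => //; exact: (jmeas_nmeas _ (nmeas_upd n _)).
- by move=> t _; exact: iint_ge0.
- exact: measurable_iint_upd.
- by move=> t _; exact: iint_ge0.
- exact: measurable_iint_upd.
Qed.

Lemma iintZl n (c : R) f : 0 <= c -> (forall x, 0 <= f x)%E -> nmeas f ->
  (iint n (fun x => c%:E * f x) = c%:E * iint n f)%E.
Proof.
move=> c0; elim: n f => [|n IH] f f0 nf //=.
rewrite -ge0_integralZl//.
- apply: eq_integral => t _; apply: IH => //; exact: (jmeas_nmeas _ (nmeas_upd n _)).
- exact: measurable_iint_upd.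
- by move=> t _; exact: iint_ge0.
Qed.

Lemma nmeasZ (c : R) f : nmeas f -> nmeas (fun x => c%:E * f x)%E.
Proof. by move=> nf dU U x mx; apply: measurable_funeM; exact: nf. Qed.

Lemma nmeasD f g : nmeas f -> nmeas g -> nmeas (fun x => f x + g x)%E.
Proof.
by move=> nf ng dU U x mx; apply: emeasurable_funD; [exact: nf|exact: ng].
Qed.

Lemma nmeas_sum (I : Type) (s : seq I) (F : I -> (nat -> R) -> \bar R) :
  (forall i, nmeas (F i)) -> nmeas (fun x => \sum_(i <- s) F i x)%E.
Proof.
move=> nF dU U x mx; elim: s => [|i s IH].
  by under eq_fun do rewrite big_nil; exact: measurable_cst.
by under eq_fun do rewrite big_cons; apply: emeasurable_funD => //; exact: nF.
Qed.

Lemma iint_sum n (I : Type) (s : seq I) (F : I -> (nat -> R) -> \bar R) :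
  (forall i x, 0 <= F i x)%E -> (forall i, nmeas (F i)) ->
  (iint n (fun x => \sum_(i <- s) F i x) = \sum_(i <- s) iint n (F i))%E.
Proof.
move=> F0 nF; elim: s => [|i s IH].
  rewrite big_nil (@eq_iint _ _ (fun=> 0%E)); last by move=> x; rewrite big_nil.
  exact: iint0.
rewrite big_cons -IH -iintD//.
- by apply: eq_iint => x; rewrite big_cons.
- by move=> x; exact: sume_ge0.
- exact: nmeas_sum.
Qed.

Lemma iint_opp n f : (forall x, 0 <= f x)%E -> nmeas f ->
  iint n f = iint n (fun x => f (fun i => - x i)).
Proof.
elim: n f => [|n IH] f f0 nf /=.
  (* After all integrations the base point is the zero sequence, which negation fixes. *)
  by congr f; apply/funext => i; rewrite oppr0.
rewrite ge0_integral_oppr; last 2 first.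
- exact: measurable_iint_upd.
- by move=> t; exact: iint_ge0.
apply: eq_integral => t _.
rewrite IH//; last exact: (jmeas_nmeas _ (nmeas_upd n _)).
by apply: eq_iint => x; congr f; apply/funext => i; rewrite /upd; case: ifP.
Qed.

Lemma upd_ltn n t x (i : 'I_n) : upd n t x i = x i.
Proof. by rewrite /upd (ltn_eqF (ltn_ord i)). Qed.

Lemma upd_eq n t x : upd n t x n = t.
Proof. by rewrite /upd eqxx. Qed.

Lemma nmeas_prod n (w : R -> R) : measurable_fun setT w ->
  nmeas (fun x => (\prod_(i < n) w (x i))%:E).
Proof.
move=> mw dU U x mx; apply/measurable_EFinP; elim: n => [|n IH].
  by under eq_fun do rewrite big_ord0; exact: measurable_cst.
under eq_fun do rewrite big_ord_recr/=.
by apply: measurable_funM => //; exact: measurableT_comp.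
Qed.

Lemma iint_prod n (w : R -> R) (c : R) : measurable_fun setT w -> (forall t, 0 <= w t) ->
  (\int[lam]_t (w t)%:E = c%:E)%E ->
  iint n (fun x => (\prod_(i < n) w (x i))%:E) = (c ^+ n)%:E.
Proof.
move=> mw w0 wc; elim: n => [|n IH]; first by rewrite /= big_ord0.
have c0 : 0 <= c.
  by rewrite -lee_fin -wc; apply: integral_ge0 => t _; rewrite lee_fin.
rewrite /=; transitivity (\int[lam]_t ((c ^+ n)%:E * (w t)%:E))%E.
  apply: eq_integral => t _.
  rewrite (@eq_iint _ _ (fun x => ((w t)%:E * (\prod_(i < n) w (x i))%:E)%E)).
    rewrite iintZl ?IH 1?muleC//; last exact: nmeas_prod.
    by move=> x; rewrite lee_fin prodr_ge0.
  move=> x; rewrite big_ord_recr/= -/(upd n t x n) upd_eq mulrC EFinM; congr (_ * (_)%:E)%E.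
  by apply: eq_bigr => i _; rewrite -/(upd n t x i) upd_ltn.
rewrite ge0_integralZl// ?wc -?EFinM ?exprSr//.
- exact/measurable_EFinP.
- by move=> t _; rewrite lee_fin.
- by rewrite lee_fin exprn_ge0.
Qed.

Lemma nmeas_prodcos n (w : R -> R) (A : R) (b : nat -> R) : measurable_fun setT w ->
  nmeas (fun x => (\prod_(i < n) w (x i) * (1 + cos (A + \sum_(i < n) b i * x i)))%:E).
Proof.
move=> mw dU U x mx; apply/measurable_EFinP; apply: measurable_funM.
  by have /measurable_EFinP := nmeas_prod n mw mx.
apply: measurable_funD => //; apply: (bdmeas_cos _).1.
apply: measurable_funD => //; apply: measurable_sum => i.
by apply: measurable_funM.
Qed.

(** The hypothesis on [w] expresses that its sine transform vanishes, as for an even function: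
    integrating out one variable multiplies the oscillating part by [phi] and leaves the phase [A]
    unchanged, so the transform of a product window is a product. *)
Lemma iint_prodcos n (w phi : R -> R) (A : R) (b : nat -> R) :
  measurable_fun setT w -> (forall t, 0 <= w t) ->
  (forall t, 0 <= phi t <= phi 0) ->
  (\int[lam]_t (w t)%:E = (phi 0)%:E)%E ->
  (forall a c, \int[lam]_t (w t * (1 + cos (a + c * t)))%:E
     = (phi 0 + cos a * phi c)%:E)%E ->
  iint n (fun x => (\prod_(i < n) w (x i) * (1 + cos (A + \sum_(i < n) b i * x i)))%:E)
  = (phi 0 ^+ n + cos A * \prod_(i < n) phi (b i))%:E.
Proof.
move=> mw w0 phi0 wphi wcos; elim: n A => [|n IH] A.
  by rewrite /= !big_ord0 addr0 expr0 mul1r mulr1.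
have cos0 (a : R) : 0 <= 1 + cos a by rewrite -lerBlDl sub0r cos_geN1.
set Q := \prod_(i < n) phi (b i).
have Q0 : 0 <= Q by apply: prodr_ge0 => i _; case/andP: (phi0 (b i)).
have QP : 0 <= phi 0 ^+ n - Q.
  rewrite subr_ge0 /Q -[n in phi 0 ^+ n](card_ord n) -prodr_const.
  by apply: ler_prod => i _; exact: phi0.
(* The inner value [phi 0 ^+ n + Q * cos _] is split as [(phi 0 ^+ n - Q) + Q * (1 + cos _)], both
   parts nonnegative because [0 <= Q <= phi 0 ^+ n]. *)
rewrite /=; transitivity (\int[lam]_t ((phi 0 ^+ n - Q)%:E * (w t)%:E
    + Q%:E * (w t * (1 + cos (A + b n * t)))%:E))%E.
  apply: eq_integral => t _.
  rewrite (@eq_iint _ _ (fun x => ((w t)%:E * (\prod_(i < n) w (x i) *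
      (1 + cos (A + b n * t + \sum_(i < n) b i * x i)))%:E)%E)).
    rewrite iintZl ?IH//.
    - by rewrite -!EFinM -EFinD; congr (_%:E); rewrite -/Q; ring.
    - by move=> x; rewrite lee_fin mulr_ge0// prodr_ge0.
    - exact: nmeas_prodcos.
  move=> x; rewrite !big_ord_recr/= -/(upd n t x n) upd_eq -EFinM; congr (_%:E).
  rewrite [RHS]mulrCA mulrA; congr (_ * (1 + cos _)).
    by congr (_ * _); apply: eq_bigr => i _; rewrite -/(upd n t x i) upd_ltn.
  rewrite addrA addrAC; congr (_ + _).
  by apply: eq_bigr => i _; rewrite -/(upd n t x i) upd_ltn.
have mwc : measurable_fun setT (fun t => (w t * (1 + cos (A + b n * t)))%:E).
  apply/measurable_EFinP; apply: measurable_funM => //.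
  apply: measurable_funD => //; apply: (bdmeas_cos _).1; exact: measurable_affine.
have mwE : measurable_fun setT (fun t => (w t)%:E) by exact/measurable_EFinP.
rewrite ge0_integralD//; last 4 first.
- by move=> t _; rewrite -EFinM lee_fin mulr_ge0.
- exact: measurable_funeM.
- by move=> t _; rewrite -EFinM lee_fin !mulr_ge0.
- exact: measurable_funeM.
have intZ (c : R) (g : R -> R) : 0 <= c -> (forall t, 0 <= g t) ->
    measurable_fun setT (fun t => (g t)%:E) ->
    (\int[lam]_t (c%:E * (g t)%:E) = c%:E * \int[lam]_t (g t)%:E)%E.
  by move=> c0 g0 mg; rewrite ge0_integralZl// => t _; rewrite lee_fin.
rewrite !intZ// => [|t]; last by rewrite mulr_ge0.
rewrite wphi wcos -!EFinM -EFinD big_ord_recr/= -/Q exprSr; congr (_%:E).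
ring.
Qed.

End iterated_integral.

(** * The Fejer kernel *)

Section fejer.
Context (R : realType) (a : R).
Hypothesis a0 : 0 < a.

Let lam := @lebesgue_measure R.

Definition tri (t : R) : R := Num.max 0 (1 - `|t| / a).

(* The Fourier transform of [tri]; it is nonnegative because [tri] is the
   autocorrelation of an indicator function. *)
Definition fejer (b : R) : R :=
  if b == 0 then a else 2 * (1 - cos (b * a)) / (a * b ^+ 2).

Lemma fejer0 : fejer 0 = a.
Proof. by rewrite /fejer eqxx. Qed.

Lemma tri_ge0 t : 0 <= tri t.
Proof. by rewrite /tri le_max lexx. Qed.

Lemma tri_le1 t : tri t <= 1.
Proof. by rewrite /tri ge_max ler01 lerBlDr lerDl divr_ge0// ltW. Qed.

Lemma tri_eq0 t : a <= `|t| -> tri t = 0.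
Proof.
by move=> at0; rewrite /tri max_l// subr_le0 ler_pdivlMr// mul1r.
Qed.

Lemma measurable_tri : measurable_fun setT tri.
Proof.
apply: measurable_maxr => //; apply: measurable_funB => //.
apply: measurable_funM => //; exact: measurableT_comp.
Qed.

Lemma triE_pos t : 0 <= t <= a -> tri t = 1 - t / a.
Proof.
move=> /andP[t0 ta]; rewrite /tri ger0_norm// max_r// subr_ge0.
by rewrite ler_pdivrMr// mul1r.
Qed.

Lemma triE_neg t : - a <= t <= 0 -> tri t = 1 + t / a.
Proof.
move=> /andP[ta t0]; rewrite /tri ler0_norm// mulNr opprK max_r//.
by rewrite -lerBlDl sub0r ler_pdivlMr// mulN1r.
Qed.

Lemma integral_tri_mul (g : R -> R) : (forall t, 0 <= g t) -> measurable_fun setT g ->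
  (\int[lam]_t (tri t * g t)%:E =
   \int[lam]_(t in `[(- a)%R, 0%R]) ((1 + t / a) * g t)%:E
   + \int[lam]_(t in `[0%R, a]) ((1 - t / a) * g t)%:E)%E.
Proof.
move=> g0 mg.
have mh : measurable_fun setT (fun t => (tri t * g t)%:E).
  by apply/measurable_EFinP; apply: measurable_funM => //; exact: measurable_tri.
have aNa : - a <= 0 by rewrite oppr_le0 ltW.
transitivity (\int[lam]_(t in `[(- a)%R, 0%R]%classic `|` `]0%R, a]%classic) (tri t * g t)%:E)%E.
  rewrite [RHS]integral_mkcond; apply: eq_integral => t _; rewrite patchE.
  case: ifP => // /negbT; rewrite notin_setE/= !in_itv/= => h.
  rewrite tri_eq0 ?mul0r// leNgt; apply/negP; rewrite ltr_norml => /andP[h1 h2].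
  by apply: h; case: (leP t 0) => t0; [left|right]; rewrite ltW.
rewrite ge0_integral_setU//=.
- congr (_ + _)%E.
    by apply: eq_integral => t; rewrite inE/= in_itv/= => h; rewrite triE_neg.
  rewrite -integral_itv_obnd_cbnd.
    apply: eq_integral => t; rewrite inE/= in_itv/= => /andP[t0 ta].
    by rewrite triE_pos// ta ltW.
  apply/measurable_EFinP; apply: measurable_funM; last exact: measurable_funTS.
  by apply: measurable_funB => //; exact: measurable_funM.
- exact: measurable_funTS.
- by move=> t _; rewrite lee_fin mulr_ge0// tri_ge0.
- apply/disj_setPS => t /= []; rewrite !in_itv/= => /andP[_ t0] /andP[].
  by rewrite ltNge t0.
Qed.

Lemma integral_tri_cos (A c : R) :
  (\int[lam]_t (tri t * (1 + cos (A + c * t)))%:E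
    = (fejer 0 + cos A * fejer c)%:E)%E.
Proof.
have a_neq0 := lt0r_neq0 a0.
have cg : continuous (fun t : R => 1 + cos (A + c * t)).
  by move=> t; apply: cvgD; [exact: cvg_cst|exact: continuous_cosL].
rewrite integral_tri_mul; last 2 first.
- by move=> t; rewrite -lerBlDl sub0r cos_geN1.
- exact: continuous_measurable_fun.
have cl (q : R) : continuous (fun t : R => (1 + q * t) * (1 + cos (A + c * t))).
  move=> t; apply: cvgM; last exact: cg.
  by apply: cvgD; [exact: cvg_cst|apply: cvgM; [exact: cvg_cst|exact: cvg_id]].
(* An antiderivative of [(1 + q * t) * (1 + cos (A + c * t))]; the slopes [q = 1 / a] and
   [q = - 1 / a] serve the two sides of the triangle. *)
pose F (q : R) t := if c == 0 then (t + q / 2 * (t * t)) * (1 + cos A)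
  else t + q / 2 * (t * t) + ((1 + q * t) * (c^-1 * sin (A + c * t))
                              + q / c ^+ 2 * cos (A + c * t)).
have dF (q t : R) : is_derive t (1 : R) (F q) ((1 + q * t) * (1 + cos (A + c * t))).
  rewrite /F; have [->|c0] := eqVneq c 0.
    rewrite mul0r addr0.
    apply: is_derive_eq; rewrite /GRing.scale/=; by field.
  have h1 := is_derive_cosL A c t; have h2 := is_derive_sinL A c t.
  apply: is_derive_eq; rewrite /GRing.scale/=; by field.
have h u v q : u <= v -> (\int[lam]_(t in `[u, v])
    ((1 + q * t) * (1 + cos (A + c * t)))%:E = (F q v - F q u)%:E)%E.
  by move=> uv; exact: (ftc_cc uv (dF q) (cl q)).
under eq_integral do rewrite mulrC.
have -> : (\int[lam]_(t in `[(- a)%R, 0%R]) ((1 + cos (A + c * t)) * (1 + t / a))%:E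
   = (F a^-1 0 - F a^-1 (- a))%:E)%E.
  rewrite -h ?oppr_le0 ?ltW//.
  by apply: eq_integral => t _; rewrite mulrC (mulrC t).
have -> : (\int[lam]_(t in `[0%R, a]) ((1 - t / a) * (1 + cos (A + c * t)))%:E
   = (F (- a^-1) a - F (- a^-1) 0)%:E)%E.
  rewrite -h ?ltW//.
  by apply: eq_integral => t _; rewrite mulNr (mulrC t).
rewrite -EFinD; congr (_%:E); rewrite /F /fejer eqxx.
have [_|c0] := eqVneq c 0; first by field.
rewrite !mulr0 !addr0 (mulrN c a) cosB cosD; by field; rewrite c0 a_neq0.
Qed.

Lemma integral_tri : (\int[lam]_t (tri t)%:E = (fejer 0)%:E)%E.
Proof.
have a_neq0 := lt0r_neq0 a0.
(* At phase [pi / 2] and frequency 0 the cosine vanishes and only [tri] remains. *)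
have := integral_tri_cos (pi / 2) 0; rewrite cos_pihalf mul0r addr0 => <-.
by apply: eq_integral => t _; rewrite mul0r addr0 cos_pihalf addr0 mulr1.
Qed.

Lemma fejer_ge0 b : 0 <= fejer b.
Proof.
rewrite /fejer; case: ifP => _; first exact: ltW.
apply: divr_ge0; first by rewrite mulr_ge0// subr_ge0 cos_le1.
by rewrite mulr_ge0 ?sqr_ge0// ltW.
Qed.

(** At phase [pi] the cosine formula writes [fejer 0 - fejer b] as the integral of the nonnegative
    function [tri t * (1 - cos (b * t))]. *)
Lemma fejer_le b : fejer b <= fejer 0.
Proof.
rewrite -subr_ge0 -lee_fin.
have := integral_tri_cos pi b; rewrite cospi mulN1r => <-.
apply: integral_ge0 => t _.
by rewrite lee_fin mulr_ge0 ?tri_ge0// -lerBlDl sub0r cos_geN1.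
Qed.

Lemma measurable_fejer : measurable_fun setT fejer.
Proof.
apply: measurable_fun_ifT => //; first exact: measurable_fun_eqr.
apply: measurable_funM.
  apply: measurable_funM => //; apply: measurable_funB => //.
  by apply: (bdmeas_cos _).1; apply: measurable_funM.
have -> : (fun b : R => (a * b ^+ 2)^-1) = fun b => (a * b ^+ 2) `^ (-1).
  by apply/funext => b; rewrite powR_inv1// mulr_ge0 ?sqr_ge0// ltW.
apply: (@measurableT_comp _ _ _ _ _ _ (@powR R ^~ (-1))).
  exact: measurable_powR.
by apply: measurable_funM => //; exact: measurable_funX.
Qed.

(** The bounds [fejer b <= a] and [fejer b * b ^+ 2 <= 4 / a] combine into [fejer b * (2 + 2 * b ^+
    2) <= 2 * a + 8 / a], and (n + 1)^2 <= 2 + 2 n^2. *)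
Lemma fejer_decay b (n : nat) : n%:R <= `|b| ->
  fejer b <= (2 * a + 8 / a) / n.+1%:R ^+ 2.
Proof.
move=> nb; rewrite ler_pdivlMr ?exprn_gt0//.
have f0 := fejer_ge0 b.
have f1 : fejer b <= a by have := fejer_le b; rewrite {2}/fejer eqxx.
have f2 : fejer b * b ^+ 2 <= 4 / a.
  rewrite /fejer; case: eqP => [->|/eqP b0].
    by rewrite expr0n/= mulr0 divr_ge0// ltW.
  have := cos_geN1 (b * a); move: (cos (b * a)) => x x1.
  have -> : 2 * (1 - x) / (a * b ^+ 2) * b ^+ 2 = 2 * (1 - x) / a.
    by field; rewrite b0 lt0r_neq0.
  rewrite ler_pM2r ?invr_gt0//; lra.
have nb2 : n%:R ^+ 2 <= b ^+ 2.
  by rewrite -(real_normK (num_real b)) lerXn2r// nnegrE.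
apply: (@le_trans _ _ (fejer b * (2 + 2 * b ^+ 2))).
  apply: ler_wpM2l => //; rewrite -natr1.
  have := sqr_ge0 (n%:R - 1 : R); move: nb2; set x := n%:R; nra.
have -> : 8 / a = 2 * (4 / a) by rewrite mulrA; congr (_ / _); ring.
by rewrite mulrDr mulrCA (mulrC (fejer b) 2); lra.
Qed.

End fejer.

(** * Tiling bound *)

Section euclidean_norm.
Context (R : realType) (n : nat).
Implicit Types x y : 'rV[R]_n.

Lemma dotp_ge0 x : 0 <= dotp x x.
Proof. by apply: sumr_ge0 => i _; rewrite -expr2 sqr_ge0. Qed.

Lemma enorm_ge0 x : 0 <= enorm x.
Proof. exact: sqrtr_ge0. Qed.

Lemma enorm_sqr x : enorm x ^+ 2 = dotp x x.
Proof. by rewrite sqr_sqrtr// dotp_ge0. Qed.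

Lemma coord_le_enorm x (i : 'I_n) : `|x ord0 i| <= enorm x.
Proof.
rewrite -(@ler_pXn2r _ 2)// ?nnegrE// ?enorm_ge0// enorm_sqr real_normK ?num_real//.
rewrite /dotp (bigD1 i)//= -expr2 lerDl.
by apply: sumr_ge0 => j _; rewrite -expr2 sqr_ge0.
Qed.

(** The factor [n] instead of its square root suffices throughout. The absolute value of [c] covers
    [n = 0], where the hypothesis says nothing about its sign. *)
Lemma enorm_le x (c : R) : (forall i, `|x ord0 i| <= c) -> enorm x <= n%:R * `|c|.
Proof.
move=> xc; rewrite -(@ler_pXn2r _ 2)// ?nnegrE// ?enorm_ge0 ?mulr_ge0//.
rewrite enorm_sqr exprMn real_normK ?num_real//.
apply: (@le_trans _ _ (\sum_(i < n) c ^+ 2)).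
  apply: ler_sum => i _; rewrite -expr2 -(real_normK (num_real (x _ _))).
  by rewrite lerXn2r// nnegrE// (le_trans _ (xc i)).
rewrite sumr_const card_ord -[leLHS]mulr_natl ler_wpM2r ?sqr_ge0//.
by rewrite -natrX ler_nat; case: (n) => // k; rewrite leq_pmulr.
Qed.

(** Cauchy-Schwarz, from the identity |y|^2 (|x|^2 |y|^2 - (x.y)^2) = | |y|^2 x - (x.y) y |^2; the
    case y = 0 is apart because |y|^2 is divided out. *)
Lemma normr_dotp x y : `|dotp x y| <= enorm x * enorm y.
Proof.
rewrite -(@ler_pXn2r _ 2)// ?nnegrE// ?mulr_ge0 ?enorm_ge0//.
rewrite real_normK ?num_real// exprMn !enorm_sqr.
have e : dotp y y * (dotp x x * dotp y y - dotp x y ^+ 2) =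
   \sum_(i < n) (dotp y y * x ord0 i - dotp x y * y ord0 i) ^+ 2.
  rewrite (eq_bigr (fun i => dotp y y ^+ 2 * (x ord0 i * x ord0 i)
     - 2 * dotp y y * dotp x y * (x ord0 i * y ord0 i)
     + dotp x y ^+ 2 * (y ord0 i * y ord0 i))) => [|i _]; last by ring.
  by rewrite big_split/= sumrB -!mulr_sumr -/(dotp x y) -/(dotp x x) -/(dotp y y); ring.
have := dotp_ge0 y; rewrite le_eqVlt => /predU1P[y0|y0].
  have y00 i : y ord0 i = 0.
    have := coord_le_enorm y i; rewrite /enorm -y0 sqrtr0 normr_le0 => /eqP; exact.
  rewrite -y0 mulr0 /dotp big1 ?expr0n//= => i _; by rewrite y00 mulr0.
rewrite -subr_ge0 -(pmulr_rge0 _ y0) e; apply: sumr_ge0 => i _; exact: sqr_ge0.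
Qed.

Lemma measurable_dotp d (S : measurableType d) (X Z : S -> 'rV[R]_n) :
  (forall i, measurable_fun setT (fun s => X s ord0 i)) ->
  (forall i, measurable_fun setT (fun s => Z s ord0 i)) ->
  measurable_fun setT (fun s => dotp (X s) (Z s)).
Proof. by move=> mX mZ; apply: measurable_sum => i; exact: measurable_funM. Qed.

Lemma measurable_enorm d (S : measurableType d) (X : S -> 'rV[R]_n) :
  (forall i, measurable_fun setT (fun s => X s ord0 i)) ->
  measurable_fun setT (fun s => enorm (X s)).
Proof.
move=> mX; have ms : measurable_fun setT (@Num.sqrt R).
  by apply: continuous_measurable_fun; exact: sqrt_continuous.
by apply: (measurableT_comp ms); exact: measurable_dotp.
Qed.

End euclidean_norm.

Lemma sum_invr_sqr (R : realType) (K : nat) :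
  \sum_(k < K) (k.+1%:R ^+ 2)^-1 <= 2 :> R.
Proof.
case: K => [|K]; first by rewrite big_ord0.
(* The stronger bound 2 - 1/(K + 1) is the one that telescopes. *)
suff : \sum_(k < K.+1) (k.+1%:R ^+ 2)^-1 <= 2 - K.+1%:R^-1 :> R.
  by move=> /le_trans; apply; rewrite lerBlDr lerDl invr_ge0.
elim: K => [|K IH]; first by rewrite big_ord_recr big_ord0/= expr1n invr1; lra.
rewrite big_ord_recr/=; apply: (le_trans (lerD IH (lexx _))).
have x0 : 0 < K.+1%:R :> R by [].
rewrite -(natr1 K.+1); move: (K.+1%:R : R) x0 => x x0.
rewrite -subr_ge0.
have -> : 2 - (x + 1)^-1 - (2 - x^-1 + ((x + 1) ^+ 2)^-1) =
   (x * (x + 1) ^+ 2)^-1.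
  by field; rewrite !lt0r_neq0// addr_gt0.
by rewrite invr_ge0 mulr_ge0// ?sqr_ge0// ltW.
Qed.

Section tile_bound.
Context (R : realType) (dT : measure_display) (T : measurableType dT) (P : probability T R).
Context (n : nat) (Y : T -> 'rV[R]_n) (r c0 alpha : R).
Hypothesis mY : forall i, measurable_fun setT (fun y => Y y ord0 i).
Hypothesis Yr : forall y i, `|Y y ord0 i| <= r.
Hypothesis c0_gt0 : 0 < c0.
Hypothesis ball_le : forall (x : 'rV[R]_n) (rho : R), 0 < rho ->
  (P [set y | (enorm (Y y - x) < rho)%R] <= (c0 * rho `^ alpha)%:E)%E.

Context (a m : R) (x : 'rV[R]_n).
Hypotheses (a0 : 0 < a) (m0 : 0 < m).

Let v (y : T) (i : 'I_n) : R := m * (x ord0 i - Y y ord0 i).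

Let mv i : measurable_fun setT (v ^~ i).
Proof. by apply: measurable_funM => //; exact: measurable_funB. Qed.

(* The tile [(k, b)] is the interval [k, k + 1) if [b] is false, and its mirror
   image [(-k - 1, -k]] if [b] is true. *)
Definition in_tile (p : nat * bool) (t : R) : bool :=
  (p.1%:R <= (-1) ^+ p.2 * t) && ((-1) ^+ p.2 * t < p.1.+1%:R).

Let wt (p : nat * bool) : R := (2 * a + 8 / a) / p.1.+1%:R ^+ 2.

Let wt_ge0 p : 0 <= wt p.
Proof. by rewrite divr_ge0 ?sqr_ge0// addr_ge0 ?divr_ge0 ?mulr_ge0// ltW. Qed.

Let tile K (f : {ffun 'I_n -> 'I_K * bool}) : set T :=
  [set y | forall i, in_tile (val (f i).1, (f i).2) (v y i)].

Lemma in_tile_dist p t t' : in_tile p t -> in_tile p t' -> `|t - t'| <= 1.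
Proof.
rewrite /in_tile -natr1 => /andP[h1 h2] /andP[h3 h4].
move: h1 h2 h3 h4; case: (p.2); rewrite ?expr1 ?expr0 ?mulN1r ?mul1r => h1 h2 h3 h4;
rewrite ler_norml; apply/andP; split; lra.
Qed.

Let measurable_tile K f : measurable (@tile K f).
Proof.
have -> : tile f = \bigcap_(i in [set: 'I_n]) [set y | in_tile (val (f i).1, (f i).2) (v y i)].
  by apply/seteqP; split => y /= h i => [_|]; exact: h.
apply: fin_bigcap_measurable => // i _.
have mi : measurable_fun setT (fun y => (-1) ^+ (f i).2 * v y i).
  by apply: measurable_funM.
rewrite -[X in measurable X]setTI.
rewrite (_ : [set y | _] = (fun y => (-1) ^+ (f i).2 * v y i)
    @^-1` `[(val (f i).1)%:R, (val (f i).1).+1%:R[).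
  exact: mi.
by apply/seteqP; split => y /=; rewrite in_itv.
Qed.

(** Two points of a tile differ by at most 1/m in each coordinate, hence by at most n/m in norm. A
    nonempty tile therefore lies in the open ball of radius (n + 1)/m about any of its own points;
    the extra 1 makes the inequality strict. *)
Lemma tile_measure K f : (P (@tile K f) <= (c0 * (n.+1%:R / m) `^ alpha)%:E)%E.
Proof.
have q0 : 0 < n.+1%:R / m by rewrite divr_gt0.
have [->|/set0P[y0 hy0]] := eqVneq (tile f) set0.
  by rewrite measure0 lee_fin mulr_ge0 ?powR_ge0// ltW.
apply: le_trans (ball_le (Y y0) q0).
apply: le_measure; rewrite ?inE//.
  rewrite -[X in measurable X]setTI.
  rewrite (_ : [set y | _] = (fun y => enorm (Y y - Y y0)) @^-1` `]-oo, n.+1%:R / m[).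
    apply: measurable_enorm => // i; under eq_fun do rewrite !mxE.
    exact: measurable_funB.
  by apply/seteqP; split => y /=; rewrite in_itv.
move=> y hy /=.
have := @enorm_le R n (Y y - Y y0) m^-1 => /(_ _)/le_lt_trans; apply.
  move=> i; rewrite !mxE.
  have := in_tile_dist (hy0 i) (hy i); rewrite /v -mulrBr normrM gtr0_norm//.
  by rewrite -ler_pdivlMl// mulr1; congr (`|_| <= _); ring.
by rewrite gtr0_norm ?invr_gt0// ltr_pM2r ?invr_gt0// ltr_nat.
Qed.

(** The integer part of [|t|] and the sign of [t] select one tile containing [t]. Tiles overlap at
    0, which is harmless since the other terms are nonnegative. *)
Lemma fejer_le_tile K t : `|t| < K%:R ->
  fejer a t <= \sum_(p : 'I_K * bool) wt (val p.1, p.2) * (in_tile (val p.1, p.2) t)%:R.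
Proof.
move=> tK; have tn := truncn_itv (normr_ge0 t).
have kK : (Num.trunc `|t| < K)%N.
  by rewrite -(ltr_nat R); case/andP: tn => h _; exact: le_lt_trans tK.
rewrite (bigD1 (Ordinal kK, t < 0))//=.
apply: (@le_trans _ _ (wt (Num.trunc `|t|, t < 0))).
  by case/andP: tn => h _; exact: fejer_decay.
rewrite (_ : in_tile _ _ = true) ?mulr1.
  by rewrite lerDl; apply: sumr_ge0 => p _; rewrite mulr_ge0.
move: tn; rewrite /in_tile /=; case: (ltP t 0) => t0 /=; rewrite ?expr1 ?expr0 ?mulN1r ?mul1r.
  by rewrite ltr0_norm.
by rewrite ger0_norm.
Qed.

(** All product tiles obey the same measure bound, and the sum of their weights factors into [n]
    copies of a one-dimensional sum. Two signs and the bound 2 for the sum of inverse squares give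
    the factor 4, independently of the number of tiles. *)
Lemma integral_fejer_le : 0 <= r -> (forall i, `|x ord0 i| <= r) ->
  (\int[P]_y (\prod_(i < n) fejer a (v y i))%:E
    <= ((4 * (2 * a + 8 / a)) ^+ n * (c0 * (n.+1%:R / m) `^ alpha))%:E)%E.
Proof.
(* Both [x] and [Y y] have coordinates at most [r], so [|v y i| <= 2 * m * r] and finitely many
   tiles suffice. *)
move=> r0 xr; pose K := (Num.trunc (m * (2 * r))).+1.
have vK y i : `|v y i| < K%:R.
  apply: (@le_lt_trans _ _ (m * (2 * r))); last first.
    by have /andP[] := truncn_itv (mulr_ge0 (ltW m0) (mulr_ge0 (ler0n _ 2) r0)).
  rewrite /v normrM gtr0_norm// ler_pM2l// (le_trans (ler_normB _ _))//.
  by rewrite mulr_natl mulr2n lerD.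
pose F (f : {ffun 'I_n -> 'I_K * bool}) : R := \prod_(i < n) wt (val (f i).1, (f i).2).
have F0 f : 0 <= F f by apply: prodr_ge0.
apply: (@le_trans _ _ (\int[P]_y (\sum_f (F f)%:E * (\1_(tile f) y)%:E))%E).
  apply: ge0_le_integral => //.
  - by move=> y _; rewrite lee_fin prodr_ge0// => i _; exact: fejer_ge0.
  - apply/measurable_EFinP; apply: measurable_prod => i _.
    exact: (measurableT_comp (measurable_fejer a0)).
  - apply: emeasurable_sum => f; apply: measurable_funeM; apply/measurable_EFinP.
    exact: measurable_indic.
  move=> y _; under [leRHS]eq_bigr do rewrite -EFinM; rewrite sumEFin lee_fin.
  apply: (@le_trans _ _ (\prod_(i < n) \sum_(p : 'I_K * bool)
      wt (val p.1, p.2) * (in_tile (val p.1, p.2) (v y i))%:R)).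
    apply: ler_prod => i _; apply/andP; split; [exact: fejer_ge0|exact: fejer_le_tile].
  rewrite bigA_distr_bigA/=; apply: ler_sum => f _.
  rewrite big_split/= -/(F f) ler_wpM2l// indicE.
  case: (boolP [forall i, in_tile (val (f i).1, (f i).2) (v y i)]) => [/forallP h|/forallPn[i hi]].
    by rewrite mem_set//= big1// => i _; rewrite h.
  by rewrite (bigD1 i)//= (negbTE hi) mul0r.
rewrite ge0_integral_sum//; last 2 first.
- move=> f; apply: measurable_funeM; apply/measurable_EFinP; exact: measurable_indic.
- by move=> f y _; rewrite -EFinM lee_fin mulr_ge0.
apply: (@le_trans _ _ (\sum_(f : {ffun 'I_n -> 'I_K * bool})
    (F f * (c0 * (n.+1%:R / m) `^ alpha))%:E)%E).
  apply: lee_sum => f _; rewrite ge0_integralZl//; last 2 first.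
  - apply/measurable_EFinP; exact: measurable_indic.
  - by rewrite lee_fin.
  by rewrite integral_indic// setIT EFinM lee_wpmul2l ?lee_fin// tile_measure.
rewrite sumEFin lee_fin -mulr_suml ler_wpM2r ?mulr_ge0 ?powR_ge0 ?(ltW c0_gt0)//.
rewrite /F -(bigA_distr_bigA (fun (_ : 'I_n) (p : 'I_K * bool) => wt (val p.1, p.2)))/=.
rewrite prodr_const card_ord lerXn2r// ?nnegrE.
- by apply: sumr_ge0.
- by rewrite mulr_ge0// addr_ge0 ?divr_ge0 ?mulr_ge0// ltW.
rewrite -(pair_bigA _ (fun k b => wt (val k, b)))/=.
have C0 : 0 <= 2 * a + 8 / a by rewrite addr_ge0 ?divr_ge0 ?mulr_ge0// ltW.
under eq_bigr do rewrite big_bool /wt /= -mulrDl.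
rewrite -mulr_sumr; have := sum_invr_sqr R K; move: (\sum_(k < K) _) C0 => S.
move: (2 * a + 8 / a) => C C0 S2; nra.
Qed.

End tile_bound.

(** * The support of the measure *)

Section support.
Context (R : realType) (d : nat).
Notation borel := (borelRd R d).

Lemma measurable_coord (i : 'I_d) :
  measurable_fun [set: borel] (fun y : borel => (y : 'rV[R]_d) ord0 i).
Proof.
apply: (measurability _ (RGenOInfty.measurableE R)).
move=> _ [_ [t ->] <-]; rewrite setTI. apply: sub_sigma_algebra.
apply: open_comp; last exact: interval_open.
by move=> y _; exact: coord_continuous.
Qed.

Lemma measurable_eball (x : 'rV[R]_d) (r : R) : measurable (eball x r : set borel).
Proof.
rewrite -[X in measurable X]setTI.
rewrite (_ : eball x r = (fun y : borel => enorm ((y : 'rV[R]_d) - x)) @^-1` `]-oo, r[).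
  apply: measurable_enorm => // i; under eq_fun do rewrite !mxE.
  by apply: measurable_funB => //; exact: measurable_coord.
by apply/seteqP; split => y /=; rewrite in_itv.
Qed.

Lemma measurable_halfspace (rho : R) (th : 'rV[R]_d) :
  measurable (halfspace rho th : set borel).
Proof.
rewrite -[X in measurable X]setTI.
rewrite (_ : halfspace rho th = (fun y : borel => dotp y th) @^-1` `]rho, +oo[).
  apply: measurable_dotp => // i; exact: measurable_coord.
by apply/seteqP; split => y /=; rewrite in_itv/= andbT.
Qed.

Lemma enormN (x : 'rV[R]_d) : enorm (- x) = enorm x.
Proof.
by congr Num.sqrt; apply: eq_bigr => i _; rewrite !mxE mulrNN.
Qed.

Lemma ler_enormD (x y : 'rV[R]_d) : enorm (x + y) <= enorm x + enorm y.
Proof.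
rewrite -(@ler_pXn2r _ 2)// ?nnegrE// ?addr_ge0 ?enorm_ge0// enorm_sqr sqrrD !enorm_sqr.
have -> : dotp (x + y) (x + y) = dotp x x + 2 * dotp x y + dotp y y.
  rewrite /dotp mulr_sumr -!big_split/=; apply: eq_bigr => i _; rewrite !mxE; ring.
by have := ler_norm (dotp x y); have := normr_dotp x y; rewrite -mulr_natl; lra.
Qed.

Lemma rational_approx (x : 'rV[R]_d) (e : R) : 0 < e ->
  exists q : 'rV[rat]_d, enorm (x - map_mx ratr q) < e.
Proof.
move=> e0; pose c := e / d.+1%:R; have c0 : 0 < c by rewrite divr_gt0.
have h (i : 'I_d) : exists q : rat, `|x ord0 i - ratr q| <= c.
  have /rat_in_itvoo[q] : x ord0 i - c < x ord0 i + c by lra.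
  rewrite in_itv/= => /andP[h1 h2]; exists q.
  by rewrite ler_norml; apply/andP; split; lra.
have [f hf] := choice h.
exists (\row_i f i); apply: (@le_lt_trans _ _ (d%:R * `|c|)).
  by apply: enorm_le => i; rewrite !mxE.
rewrite gtr0_norm// /c mulrCA -[ltRHS]mulr1 ltr_pM2l//.
by rewrite ltr_pdivrMr// mul1r ltr_nat.
Qed.

Context (mu : {measure set borel -> \bar R}).

Let cell (p : 'rV[rat]_d * nat) : set 'rV[R]_d := eball (map_mx ratr p.1) p.2.+1%:R^-1.

Let null_cell (n : nat) : set 'rV[R]_d :=
  if unpickle n is Some p then if mu (cell p) == 0%E then cell p else set0 else set0.

(** A point with a null ball around it also lies in a null ball with rational centre and radius 1/(k
    + 1). There are countably many of these, so the complement of the support is both measurable and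
    null. *)
Lemma setC_msupport : ~` msupport mu = \bigcup_n null_cell n.
Proof.
apply/seteqP; split => [x|x [n _]].
  move=> /existsNP[r /not_implyP[r0 /negP]]; rewrite -leNgt measure_le0 => /eqP mr.
  pose k := Num.trunc (2 / r); pose e : R := k.+1%:R^-1.
  have e0 : 0 < e by rewrite invr_gt0.
  have er : 2 * e < r.
    have /andP[_] := truncn_itv (divr_ge0 (ler0n R 2) (ltW r0)).
    by rewrite -/k /e ltr_pdivrMr// mulrC -ltr_pdivrMr.
  have [q xq] := rational_approx x e0.
  exists (pickle (q, k)) => //; rewrite /null_cell pickleK.
  suff /eqP -> : mu (cell (q, k)) = 0%E by [].
  apply/eqP; rewrite -measure_le0 -mr; apply: le_measure; rewrite ?inE.
  - exact: measurable_eball.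
  - exact: measurable_eball.
  move=> y; rewrite /cell /eball/= -/e => yq.
  have -> : y - x = (y - map_mx ratr q) + - (x - map_mx ratr q).
    by rewrite opprB addrA subrK.
  by apply: (le_lt_trans (ler_enormD _ _)); rewrite enormN; lra.
rewrite /null_cell; case: (unpickle n) => //= -[q k]; case: eqP => // m0 xq mx.
move: xq; rewrite /cell /eball/= => xq.
set e := _^-1 in xq; have r0 : 0 < e - enorm (x - map_mx ratr q) by rewrite subr_gt0.
have := mx _ r0; apply/negP; rewrite -leNgt -m0; apply: le_measure; rewrite ?inE.
- exact: measurable_eball.
- exact: measurable_eball.
move=> y; rewrite /cell /eball/= -/e => yx.
have -> : y - map_mx ratr q = (y - x) + (x - map_mx ratr q) by rewrite addrA subrK.
by apply: (le_lt_trans (ler_enormD _ _)); lra.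
Qed.

Lemma measurable_null_cell n : measurable (null_cell n : set borel).
Proof.
rewrite /null_cell; case: (unpickle n) => // p; case: eqP => // _.
exact: measurable_eball.
Qed.

Lemma setC_msupport_null : mu (~` msupport mu) = 0%E.
Proof.
rewrite setC_msupport; apply: measure_negligible.
  by apply: bigcup_measurable => n _; exact: measurable_null_cell.
apply: negligible_bigcup => n; exists (null_cell n); split => //.
  exact: measurable_null_cell.
by rewrite /null_cell; case: (unpickle n) => // p; case: eqP.
Qed.

Lemma measurable_msupport : measurable (msupport mu : set borel).
Proof.
rewrite -[msupport mu]setCK; apply: measurableC; rewrite setC_msupport.
by apply: bigcup_measurable => n _; exact: measurable_null_cell.
Qed.

Hypothesis mu1 : mu (msupport mu) = 1%E.

(** The mass 1 is prescribed on the support only; it is the total mass because the complement is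
    null. *)
Lemma mu_setT : mu setT = 1%E.
Proof.
rewrite -(setvU (msupport mu)) measureU ?setICl//.
- by rewrite [X in (X + _)%E](_ : _ = 0%E) ?add0e; [exact: mu1|exact: setC_msupport_null].
- by apply: measurableC; exact: measurable_msupport.
- exact: measurable_msupport.
Qed.

Context (r0 : R).
Hypothesis sub : msupport mu `<=` eball 0 r0.

Lemma radius_gt0 : 0 < r0.
Proof.
have [x Ex] : msupport mu !=set0.
  apply/set0P/negP => /eqP E; move: mu1; rewrite E measure0 => /esym/eqP.
  by rewrite onee_eq0.
by have := sub Ex; rewrite /eball/= => /(le_lt_trans (enorm_ge0 _)).
Qed.

(** This permits replacing the identity of the space by a map bounded everywhere without changing
    any measure. *)
Lemma eq_mu_eball (A B : set borel) : measurable A -> measurable B ->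
  A `&` eball 0 r0 = B `&` eball 0 r0 -> mu A = mu B.
Proof.
move=> mA mB AB.
have mC C : measurable C -> mu C = mu (C `&` eball 0 r0).
  move=> mC; have mE := measurable_eball 0 r0.
  rewrite -[in LHS](setUIDK C (eball 0 r0)) measureU//.
  - rewrite [X in (_ + X)%E](_ : _ = 0%E) ?adde0//.
    apply/eqP; rewrite -measure_le0 -setC_msupport_null; apply: le_measure; rewrite ?inE.
    + exact: measurableD.
    + by apply: measurableC; exact: measurable_msupport.
    + by move=> y [_ hy] /sub.
  - exact: measurableI.
  - exact: measurableD.
  - by rewrite setDE setIACA setICr setI0.
by rewrite (mC A)// (mC B)// AB.
Qed.

End support.

(** * Lower bound for the directional integrals *)

Lemma nmeas_integral (R : realType) dS (S : measurableType dS)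
    (m : {sigma_finite_measure set S -> \bar R}) (f : S -> (nat -> R) -> \bar R) :
  (forall s x, 0 <= f s x)%E -> jmeas f -> nmeas (fun x => \int[m]_s f s x)%E.
Proof.
move=> f0 jf dU U x mx.
apply: (measurable_fun_fubini_tonelli_F (m2 := m)
  (fun z : U * S => f z.2 (fun i => x i z.1))) => [|z]; last exact: f0.
apply: (jf _ _ snd (fun i z => x i z.1)); first exact: measurable_snd.
by move=> i; apply: (measurableT_comp (mx i)); exact: measurable_fst.
Qed.

Section core.
Context (R : realType) (dT : measure_display) (T : measurableType dT) (P : probability T R).
Context (d : nat) (Y : T -> 'rV[R]_d) (r0 c0 alpha : R).
Hypotheses (d0 : (0 < d)%N) (r0_gt0 : 0 < r0) (c0_gt0 : 0 < c0) (alpha_gt0 : 0 < alpha).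
Hypothesis mY : forall i, measurable_fun setT (fun y => Y y ord0 i).
Hypothesis Yr : forall y, enorm (Y y) < r0.
Hypothesis ball_le : forall (x : 'rV[R]_d) (rho : R), 0 < rho ->
  (P [set y | (enorm (Y y - x) < rho)%R] <= (c0 * rho `^ alpha)%:E)%E.
Context (N : nat) (z : 'I_N -> 'rV[R]_d).
Hypotheses (N0 : (0 < N)%N) (zr : forall j, enorm (z j) < r0).

Let lam := @lebesgue_measure R.

Definition vec (x : nat -> R) : 'rV[R]_d := \row_(i < d) x i.

Definition rdisc (t : R) (v : 'rV[R]_d) : R :=
  hdisc P (fun j => dotp (z j) v) (fun y => dotp (Y y) v) t.

(* [rho] is multiplied by the norm of the direction instead of dividing the
   direction by its norm, so that no inverse occurs. *)
Definition sqdisc (rho : R) (x : nat -> R) : \bar R :=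
  if (0 <= rho) && (enorm (vec x) < 1) then
    (rdisc (enorm (vec x) * rho) (vec x) ^+ 2)%:E else 0%E.

Definition dirdisc (x : nat -> R) : \bar R := (\int[lam]_rho sqdisc rho x)%E.

Lemma sqdisc_ge0 rho x : (0 <= sqdisc rho x)%E.
Proof. by rewrite /sqdisc; case: ifP => // _; rewrite lee_fin sqr_ge0. Qed.

Lemma dirdisc_ge0 x : (0 <= dirdisc x)%E.
Proof. by apply: integral_ge0 => rho _; exact: sqdisc_ge0. Qed.

Lemma vecN x : vec (fun i => - x i) = - vec x.
Proof. by apply/rowP => i; rewrite !mxE. Qed.

Lemma dotpNr (u v : 'rV[R]_d) : dotp u (- v) = - dotp u v.
Proof. by rewrite /dotp -sumrN; apply: eq_bigr => i _; rewrite mxE mulrN. Qed.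

Lemma measurable_vec dU (U : measurableType dU) (x : nat -> U -> R) (i : 'I_d) :
  (forall i, measurable_fun setT (x i)) ->
  measurable_fun setT (fun u => vec (fun j => x j u) ord0 i).
Proof. by move=> mx; under eq_fun do rewrite mxE; exact: mx. Qed.

Lemma jmeas_sqdisc : jmeas (sqdisc : measurableTypeR R -> _).
Proof.
move=> dU U u x mu mx.
have mvec i := measurable_vec i mx.
have me : measurable_fun setT (fun w => enorm (vec (fun j => x j w))).
  exact: measurable_enorm.
rewrite /sqdisc; apply: measurable_fun_ifT.
- apply: measurable_and; first exact: measurable_fun_ler.
  exact: measurable_fun_ltr.
- apply/measurable_EFinP; apply: measurable_funX.
  apply: (bdmeas_hdisc P (a := fun j w => dotp (z j) (vec (fun i => x i w)))
     (U := fun q => dotp (Y q.2) (vec (fun i => x i q.1)))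
     (r := fun w => enorm (vec (fun j => x j w)) * u w) _ _ _).1.
  + by move=> j; apply: measurable_dotp.
  + apply: measurable_dotp => i.
      by apply: (measurableT_comp (mY i)); exact: measurable_snd.
    by apply: (measurableT_comp (mvec i)); exact: measurable_fst.
  + exact: measurable_funM.
- exact: measurable_cst.
Qed.

Lemma nmeas_dirdisc : nmeas dirdisc.
Proof. by apply: nmeas_integral; [exact: sqdisc_ge0|exact: jmeas_sqdisc]. Qed.

(** The half-width of the window: a vector with coordinates below [a] has norm at most d a = 1/(2 (1
    + r0)). It thus lies in the unit ball, and its scalar products with points of norm below [r0]
    stay below 1 < pi. *)
Let a : R := (2 * d%:R * (1 + r0))^-1.

Let a0 : 0 < a.
Proof. by rewrite invr_gt0 !mulr_gt0 ?ltr0n// addr_gt0. Qed.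

Definition window (x : nat -> R) : R := \prod_(i < d) tri a (x i).

Lemma window_ge0 x : 0 <= window x.
Proof. by apply: prodr_ge0 => i _; exact: tri_ge0. Qed.

Lemma window_le1 x : window x <= 1.
Proof.
apply: prodr_ile1 => i _; apply/andP; split; [exact: tri_ge0|exact: tri_le1].
Qed.

Lemma window_supp x : window x != 0 ->
  enorm (vec x) < 1 /\ enorm (vec x) * r0 < 1.
Proof.
move=> /prodf_neq0 wx.
have d0' : 0 < d%:R :> R by rewrite ltr0n.
have h : enorm (vec x) <= (2 * (1 + r0))^-1.
  apply: (@le_trans _ _ (d%:R * `|a|)).
    apply: enorm_le => i; rewrite mxE leNgt; apply/negP => /ltW ax.
    by move: (wx i isT); rewrite tri_eq0 ?eqxx.
  rewrite gtr0_norm// le_eqVlt; apply/orP; left; apply/eqP.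
  by rewrite /a (mulrC 2) -mulrA invfM mulrA divff ?mul1r// lt0r_neq0.
have r1 : 0 < 1 + r0 by rewrite addr_gt0.
split; apply: (le_lt_trans _ (_ : 2^-1 < 1)); try by rewrite invf_lt1 ?ltr1n.
  apply: (le_trans h); rewrite lef_pV2 ?posrE ?mulr_gt0//.
  by rewrite ler_peMr// lerDl ltW.
apply: (le_trans (ler_wpM2r (ltW r0_gt0) h)).
rewrite invfM -mulrA ler_piMr// ler_pdivrMl// mulr1; lra.
Qed.

Variable M : nat.
Hypothesis M0 : (0 < M)%N.

Let f (k : 'I_M) : R := freq R k.
Let c (k : 'I_M) : R := (pi * f k ^+ 2)^-1.

Let c_ge0 k : 0 <= c k.
Proof. by rewrite invr_ge0 mulr_ge0 ?sqr_ge0// pi_ge0. Qed.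

(** The summand 1 makes the function nonnegative, so all exchanges of integrals are instances of
    Tonelli. *)
Definition ripple (k : 'I_M) (u v : 'rV[R]_d) (x : nat -> R) : R :=
  window x * (1 + cos (f k * (dotp u (vec x) - dotp v (vec x)))).

Lemma ripple_ge0 k u v x : 0 <= ripple k u v x.
Proof.
by rewrite mulr_ge0 ?window_ge0// -lerBlDl sub0r cos_geN1.
Qed.

Lemma jmeas_ripple k u : jmeas (fun y x => (ripple k u (Y y) x)%:E).
Proof.
move=> dU U s x ms mx; apply/measurable_EFinP.
have mvec i := measurable_vec i mx.
apply: measurable_funM.
  by have /measurable_EFinP := nmeas_prod d (measurable_tri a) mx.
apply: measurable_funD => //; apply: (bdmeas_cos _).1.
apply: measurable_funM => //; apply: measurable_funB; apply: measurable_dotp => // i.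
exact: (measurableT_comp (mY i)).
Qed.

Lemma nmeas_ripple k u v : nmeas (fun x => (ripple k u v x)%:E).
Proof.
move=> dU U x mx; apply/measurable_EFinP.
have mvec i := measurable_vec i mx.
apply: measurable_funM.
  by have /measurable_EFinP := nmeas_prod d (measurable_tri a) mx.
apply: measurable_funD => //; apply: (bdmeas_cos _).1.
by apply: measurable_funM => //; apply: measurable_funB; exact: measurable_dotp.
Qed.

Lemma iint_ripple k u v : iint d (fun x => (ripple k u v x)%:E) =
  (a ^+ d + \prod_(i < d) fejer a (f k * (u ord0 i - v ord0 i)))%:E.
Proof.
(* Iterated integrals use coordinates indexed by [nat], so the coefficients are extended from ['I_d]
   by 0. *)
pose b (i : nat) : R :=
  if insub i is Some j then f k * (u ord0 (j : 'I_d) - v ord0 j) else 0.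
have bE (i : 'I_d) : b i = f k * (u ord0 i - v ord0 i) by rewrite /b valK.
have := @iint_prodcos R d (tri a) (fejer a) 0 b (measurable_tri a) (tri_ge0 a)
  (fun t => _) (integral_tri a0) (integral_tri_cos a0) => /(_ _)/esym E.
rewrite cos0 mul1r in E.
under [in RHS]eq_bigr do rewrite -bE.
rewrite fejer0 in E; rewrite E; last first.
  by move=> t; rewrite fejer_ge0//= -[leRHS](fejer0 a) fejer_le.
apply: eq_iint => x; congr (_%:E); congr (_ * (1 + cos _)).
rewrite add0r /dotp -sumrB mulr_sumr; apply: eq_bigr => i _.
by rewrite bE !mxE -mulrBl mulrA.
Qed.

Lemma iint_window : iint d (fun x => (window x)%:E) = (a ^+ d)%:E.
Proof.
rewrite (iint_prod d (c := a) (measurable_tri a) (tri_ge0 a))//.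
by rewrite (integral_tri a0) fejer0.
Qed.

(** The Bessel bound times the window, with the terms in the measure moved to the right so that both
    sides are nonnegative. The summands 1 contribute 2 N^2 [window] on the right and N^2 [window] on
    the left; the explicit N^2 [window] restores the balance. *)
Lemma dirdisc_lower x :
  ((\sum_(k < M) c k * (N%:R ^+ 2 * window x
      + \sum_(p : 'I_N * 'I_N) ripple k (z p.1) (z p.2) x))%:E <=
   dirdisc x + dirdisc (fun i => - x i)%R +
   \sum_(k < M) (c k * (2 * N%:R))%:E *
     \sum_(j < N) \int[P]_y (ripple k (z j) (Y y) x)%:E)%E.
Proof.
have PT : (P setT < +oo)%E by rewrite probability_setT ltry.
have mU : measurable_fun setT (fun y => dotp (Y y) (vec x)) by exact: measurable_dotp.
have bcos k j : bdmeas (fun y => cos (f k * (dotp (z j) (vec x) - dotp (Y y) (vec x)))).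
  by apply: bdmeas_cos; apply: measurable_funM => //; exact: measurable_funB.
pose E k j := \int[P]_y cos (f k * (dotp (z j) (vec x) - dotp (Y y) (vec x))).
have ripE k j : (\int[P]_y (ripple k (z j) (Y y) x)%:E = (window x * (1 + E k j))%:E)%E.
  have b1 : bdmeas (fun y => 1 + cos (f k * (dotp (z j) (vec x) - dotp (Y y) (vec x)))).
    by apply: bdmeasD => //; exact: bdmeas_cst.
  rewrite -Rint_EFin//; last exact: bdmeasZ.
  rewrite (RintZ _ PT)// (RintD _ PT)//; last exact: bdmeas_cst.
  by rewrite Rint_prob_cst.
pose stuff := \sum_(k < M) c k *
   (\sum_(i < N) \sum_(j < N) cos (f k * (dotp (z i) (vec x) - dotp (z j) (vec x))) -
      2 * N%:R * \sum_(j < N) E k j).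
have lhsE : \sum_(k < M) c k * (N%:R ^+ 2 * window x
      + \sum_(p : 'I_N * 'I_N) ripple k (z p.1) (z p.2) x) =
   window x * stuff + \sum_(k < M) c k * (2 * N%:R) * \sum_(j < N) window x * (1 + E k j).
  rewrite /stuff mulr_sumr -big_split/=; apply: eq_bigr => k _.
  rewrite -(pair_bigA _ (fun i j => ripple k (z i) (z j) x))/= /ripple.
  under [in LHS]eq_bigr do rewrite -mulr_sumr big_split/= sumr_const card_ord.
  rewrite -mulr_sumr big_split/= sumr_const card_ord -mulr_sumr big_split/= sumr_const card_ord.
  have -> : N%:R *+ N = N%:R ^+ 2 :> R by rewrite expr2 mulr_natl.
  set S1 := \sum_(i < N) \sum_(j < N) _; set S2 := \sum_(j < N) E k j; ring.
rewrite lhsE EFinD.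
have -> : (\sum_(k < M) (c k * (2 * N%:R))%:E *
     \sum_(j < N) \int[P]_y (ripple k (z j) (Y y) x)%:E =
   (\sum_(k < M) c k * (2 * N%:R) * \sum_(j < N) window x * (1 + E k j))%:E)%E.
  rewrite -sumEFin; apply: eq_bigr => k _; rewrite [RHS]EFinM -sumEFin; congr (_ * _)%E.
  by apply: eq_bigr => j _.
apply: leeD => //.
have J0 : (0 <= dirdisc x + dirdisc (fun i => - x i)%R)%E.
  by apply: adde_ge0; exact: dirdisc_ge0.
have [->|wx] := eqVneq (window x) 0; first by rewrite mul0r.
have [s1 sr] := window_supp wx.
have [st0|st0] := leP stuff 0.
  by apply: le_trans J0; rewrite lee_fin mulr_ge0_le0// window_ge0.
apply: (@le_trans _ _ stuff%:E).
  by rewrite lee_fin ler_piMl ?window_le1// ltW.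
(* At the zero vector there is no period to rescale. All cosines are then 1 and each frequency
   contributes a multiple of N^2 - 2 N^2, against the positivity of [stuff]. *)
have := enorm_ge0 (vec x); rewrite le_eqVlt => /predU1P[s0|s0].
  exfalso; move: st0; apply/negP; rewrite -leNgt.
  have v0 u : dotp u (vec x) = 0.
    by apply/eqP; rewrite -normr_le0 (le_trans (normr_dotp _ _))// -s0 mulr0.
  apply: sumr_le0 => k _; rewrite mulr_ge0_le0//.
  have E1 j : E k j = 1.
    by rewrite /E; under eq_Rintegral do rewrite !v0 subr0 mulr0 cos0; rewrite Rint_prob_cst.
  under eq_bigr do under eq_bigr do rewrite !v0 subr0 mulr0 cos0.
  under [X in _ - _ * X]eq_bigr do rewrite E1.
  rewrite !sumr_const !card_ord -mulrnA natrM.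
  rewrite subr_le0 ler_wpM2r//; by rewrite ler_peMl// ler1n.
pose s := enorm (vec x).
have dpi u : enorm u < r0 -> `|dotp u (vec x)| < pi.
  move=> ur; apply: (le_lt_trans (normr_dotp _ _)).
  apply: (@lt_trans _ _ 1); last by apply: lt_le_trans (pi_ge2 R); rewrite ltr1n.
  apply: le_lt_trans sr; rewrite mulrC ler_wpM2l ?ltW//.
have := @hdisc_ge R dT T P M N s M0 s0 (fun j => dotp (z j) (vec x))
  (fun y => dotp (Y y) (vec x)) mU (fun j => dpi _ (zr j)) (fun y => dpi _ (Yr y)).
rewrite -/stuff => le1.
(* The norm [s] is below 1, so the factor from rescaling [rho] only helps. *)
have le2 : stuff <= s^-1 * stuff.
  by rewrite ler_peMl// ?invf_ge1// ltW.
have bh (b : 'I_N -> R) V : measurable_fun setT V ->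
    bdmeas (fun t : measurableTypeR R => hdisc P b V (s * t) ^+ 2).
  move=> mV; under eq_fun do rewrite expr2.
  have h : bdmeas (fun t : measurableTypeR R => hdisc P b V (s * t)).
    apply: (bdmeas_hdisc P (S := measurableTypeR R) (a := fun j _ => b j)
      (U := fun q => V q.2) (r := fun t => s * t)) => //.
      by apply: measurableT_comp => //; exact: measurable_snd.
    by apply: measurable_funM.
  exact: bdmeasM.
have mNU : measurable_fun setT (fun y => - dotp (Y y) (vec x)) by exact: measurableT_comp.
have bF := bdmeasD (bh (fun j => dotp (z j) (vec x)) _ mU)
  (bh (fun j => - dotp (z j) (vec x)) _ mNU).
have := le_trans le2 le1.
rewrite -lee_fin (Rint_EFin _ (lam_itv_fin _) bF)//.
move=> /le_trans; apply.
rewrite /dirdisc -ge0_integralD//; last 4 first.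
- by move=> rho _; exact: sqdisc_ge0.
- exact: (jmeas_sqdisc (u := id) (x := fun i _ => x i)).
- by move=> rho _; exact: sqdisc_ge0.
- exact: (jmeas_sqdisc (u := id) (x := fun i _ => - x i)).
rewrite integral_mkcond; apply: ge0_le_integral => //.
- by move=> rho _; apply: erestrict_ge0 => t _; rewrite lee_fin addr_ge0 ?sqr_ge0.
- apply/(measurable_restrictT _ _).1 => //; apply/measurable_EFinP/measurable_funTS; exact: bF.1.
- apply: emeasurable_funD.
    exact: (jmeas_sqdisc (u := id) (x := fun i _ => x i)).
  exact: (jmeas_sqdisc (u := id) (x := fun i _ => - x i)).
move=> rho _; rewrite patchE; case: ifP => h; last first.
  by apply: adde_ge0; exact: sqdisc_ge0.
move: h; rewrite inE/= in_itv/= => /andP[rho0 _].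
rewrite /sqdisc vecN enormN rho0 s1/= -EFinD lee_fin /rdisc.
rewrite le_eqVlt; apply/orP; left; apply/eqP; congr (_ + hdisc _ _ _ _ ^+ 2).
  by apply/funext => j; rewrite dotpNr.
by apply/funext => y; rewrite dotpNr.
Qed.

Lemma integral_ripple_le k j :
  (\int[P]_y iint d (fun x => (ripple k (z j) (Y y) x)%:E) <=
   (a ^+ d + (4 * (2 * a + 8 / a)) ^+ d * (c0 * (d.+1%:R / M%:R) `^ alpha))%:E)%E.
Proof.
under eq_integral do rewrite iint_ripple EFinD.
have mf : measurable_fun setT
    (fun y => (\prod_(i < d) fejer a (f k * (z j ord0 i - Y y ord0 i)))%:E).
  apply/measurable_EFinP; apply: measurable_prod => i _.
  apply: (measurableT_comp (measurable_fejer a0)).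
  by apply: measurable_funM => //; exact: measurable_funB.
rewrite ge0_integralD//; last 2 first.
- by move=> y _; rewrite lee_fin exprn_ge0// ltW.
- by move=> y _; rewrite lee_fin; apply: prodr_ge0 => i _; exact: fejer_ge0.
rewrite integral_cst// [X in (_ * X + _)%E](_ : _ = 1%E); last exact: probability_setT.
rewrite mule1 EFinD; apply: leeD => //.
have f0 : 0 < f k by exact: freq_gt0.
have Yr' y i : `|Y y ord0 i| <= r0 by rewrite (le_trans (coord_le_enorm _ _))// ltW.
have zr' i : `|z j ord0 i| <= r0 by rewrite (le_trans (coord_le_enorm _ _))// ltW.
apply: (le_trans (integral_fejer_le mY Yr' c0_gt0 ball_le a0 f0 (ltW r0_gt0) zr')).
have C0 : 0 <= 4 * (2 * a + 8 / a).
  have a0' := ltW a0; apply: mulr_ge0 => //; apply: addr_ge0; first exact: mulr_ge0.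
  exact: divr_ge0.
have M0' : 0 < M%:R :> R by rewrite ltr0n.
rewrite lee_fin ler_wpM2l ?exprn_ge0// ler_wpM2l ?(ltW c0_gt0)//.
rewrite ge0_ler_powR ?nnegrE ?(ltW alpha_gt0)// ?divr_ge0 ?(ltW f0)//.
by rewrite ler_wpM2l// lef_pV2 ?posrE// /f /freq ler_nat leq_addr.
Qed.

(** Per frequency, up to [c k], the left side integrates to at least 2 N^2 a^d + N a^d and the terms
    in the measure to at most 2 N^2 (a^d + Q). The terms 2 N^2 a^d cancel, and Q <= a^d / (4 N)
    leaves half of N a^d. Both integrals on the right are equal because [x] and [-x] contribute the
    same. *)
Lemma total_lower :
  (4 * (2 * a + 8 / a)) ^+ d * (c0 * (d.+1%:R / M%:R) `^ alpha) <= a ^+ d / (4 * N%:R) ->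
  (((\sum_(k < M) c k) * (N%:R * a ^+ d / 2))%:E <= iint d dirdisc + iint d dirdisc)%E.
Proof.
set Q := (_ ^+ d * _) => hQ.
pose ad := a ^+ d; have ad0 : 0 < ad by rewrite exprn_gt0.
pose G x := (\sum_(k < M) ((c k * N%:R ^+ 2)%:E * (window x)%:E
   + \sum_(p : 'I_N * 'I_N) (c k)%:E * (ripple k (z p.1) (z p.2) x)%:E))%E.
pose F x := (\sum_(k < M) (c k * (2 * N%:R))%:E *
     \sum_(j < N) \int[P]_y (ripple k (z j) (Y y) x)%:E)%E.
have N0' : 0 <= N%:R ^+ 2 :> R by rewrite sqr_ge0.
have nW : nmeas (fun x => (window x)%:E) by apply: nmeas_prod; exact: measurable_tri.
have nGp k (p : 'I_N * 'I_N) :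
    nmeas (fun x => (c k)%:E * (ripple k (z p.1) (z p.2) x)%:E)%E.
  by apply: nmeasZ; exact: nmeas_ripple.
have nG1 k : nmeas (fun x => (c k * N%:R ^+ 2)%:E * (window x)%:E)%E by exact: nmeasZ.
have nGk k : nmeas (fun x => (c k * N%:R ^+ 2)%:E * (window x)%:E
   + \sum_(p : 'I_N * 'I_N) (c k)%:E * (ripple k (z p.1) (z p.2) x)%:E)%E.
  by apply: nmeasD => //; exact: nmeas_sum.
have nG : nmeas G by exact: nmeas_sum.
have Gp0 k (p : 'I_N * 'I_N) x : (0 <= (c k)%:E * (ripple k (z p.1) (z p.2) x)%:E)%E.
  by rewrite -EFinM lee_fin mulr_ge0 ?ripple_ge0.
have G10 k x : (0 <= (c k * N%:R ^+ 2)%:E * (window x)%:E)%E.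
  by rewrite -EFinM lee_fin !mulr_ge0 ?window_ge0.
have Gk0 k x : (0 <= (c k * N%:R ^+ 2)%:E * (window x)%:E
   + \sum_(p : 'I_N * 'I_N) (c k)%:E * (ripple k (z p.1) (z p.2) x)%:E)%E.
  by apply: adde_ge0 => //; exact: sume_ge0.
have G0 x : (0 <= G x)%E by exact: sume_ge0.
have nI k j : nmeas (fun x => \int[P]_y (ripple k (z j) (Y y) x)%:E)%E.
  apply: nmeas_integral; last exact: jmeas_ripple.
  by move=> y x; rewrite lee_fin ripple_ge0.
have I0 k j x : (0 <= \int[P]_y (ripple k (z j) (Y y) x)%:E)%E.
  by apply: integral_ge0 => y _; rewrite lee_fin ripple_ge0.
have c20 k : 0 <= c k * (2 * N%:R) by rewrite !mulr_ge0.
have nFk k : nmeas (fun x => (c k * (2 * N%:R))%:E *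
     \sum_(j < N) \int[P]_y (ripple k (z j) (Y y) x)%:E)%E.
  by apply: nmeasZ; exact: nmeas_sum.
have Is0 k x : (0 <= \sum_(j < N) \int[P]_y (ripple k (z j) (Y y) x)%:E)%E.
  by exact: sume_ge0.
have Fk0 k x : (0 <= (c k * (2 * N%:R))%:E *
     \sum_(j < N) \int[P]_y (ripple k (z j) (Y y) x)%:E)%E.
  by rewrite mule_ge0// lee_fin.
have nF : nmeas F by exact: nmeas_sum.
have F0 x : (0 <= F x)%E by exact: sume_ge0.
have nDN : nmeas (fun x => dirdisc (fun i => - x i)%R).
  move=> dU U x mx; apply: (nmeas_dirdisc (x := fun i u => - x i u)%R).
  by move=> i; exact: measurableT_comp.
have D0 := dirdisc_ge0.
have le1 : (iint d G <= iint d (fun x => dirdisc x + dirdisc (fun i => - x i)%R + F x))%E.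
  apply: le_iint => //; first by apply: nmeasD => //; apply: nmeasD => //; exact: nmeas_dirdisc.
  move=> x; apply: le_trans (dirdisc_lower x).
  rewrite /G -sumEFin le_eqVlt; apply/orP; left; apply/eqP.
  apply: eq_bigr => k _; rewrite mulrDr EFinD mulrA EFinM mulr_sumr -sumEFin.
  by congr (_ + _)%E; apply: eq_bigr => p _; rewrite EFinM.
have GE : ((\sum_(k < M) c k * (2 * N%:R ^+ 2 * ad + N%:R * ad))%:E <= iint d G)%E.
  rewrite /G iint_sum// -sumEFin; apply: lee_sum => k _.
  rewrite iintD//; [|by move=> x; exact: sume_ge0|exact: nmeas_sum].
  rewrite iint_sum// iintZl//; [|by rewrite mulr_ge0|by move=> x; rewrite lee_fin window_ge0].
  rewrite iint_window.
  under eq_bigr => p _.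
    rewrite iintZl//; [|by move=> x; rewrite lee_fin ripple_ge0|exact: nmeas_ripple].
    rewrite iint_ripple -EFinM; over.
  rewrite sumEFin -EFinM -EFinD lee_fin -mulr_sumr.
  rewrite -[X in _ <= X + _]mulrA -[leRHS]mulrDr ler_wpM2l//.
  rewrite big_split/= sumr_const card_prod card_ord -/ad.
  have -> : ad *+ (N * N) = N%:R ^+ 2 * ad by rewrite -natrX mulr_natl.
  have diag : N%:R * ad <= \sum_(p : 'I_N * 'I_N)
      \prod_(i < d) fejer a (f k * (z p.1 ord0 i - z p.2 ord0 i)).
    rewrite -(pair_bigA _ (fun p q => \prod_(i < d) fejer a (f k * (z p ord0 i - z q ord0 i))))/=.
    rewrite mulr_natl -[X in _ *+ X](card_ord N) -sumr_const.
    apply: ler_sum => p _; rewrite (bigD1 p)//=.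
    have -> : \prod_(i < d) fejer a (f k * (z p ord0 i - z p ord0 i)) = ad.
      by under eq_bigr do rewrite subrr mulr0 fejer0; rewrite prodr_const card_ord.
    rewrite lerDl; apply: sumr_ge0 => q _; apply: prodr_ge0 => i _; exact: fejer_ge0.
  lra.
have FE : (iint d F <= (\sum_(k < M) c k * (2 * N%:R * (N%:R * (ad + Q))))%:E)%E.
  rewrite /F iint_sum// -sumEFin; apply: lee_sum => k _.
  rewrite iintZl//; last exact: nmeas_sum.
  rewrite [leRHS](_ : _ = (c k * (2 * N%:R))%:E * (N%:R * (ad + Q))%:E)%E; last first.
    by rewrite -EFinM mulrA.
  rewrite lee_wpmul2l ?lee_fin// iint_sum//.
  rewrite mulr_natl -[X in _ *+ X](card_ord N) -sumr_const -sumEFin.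
  apply: lee_sum => j _; apply: le_trans (integral_ripple_le k j).
  rewrite iint_swap//; last exact: jmeas_ripple.
  by move=> y x; rewrite lee_fin ripple_ge0.
move: le1; rewrite iintD//; last 2 first.
- by move=> x; exact: adde_ge0.
- by apply: nmeasD => //; exact: nmeas_dirdisc.
rewrite iintD//; last exact: nmeas_dirdisc.
rewrite -(iint_opp d D0 nmeas_dirdisc) => le1.
have := le_trans GE (le_trans le1 (leeD (lexx _) FE)).
(* The subtraction is legitimate in the extended reals because the bound [FE] is finite. *)
rewrite -leeBlDr// -EFinB => /(le_trans _); apply.
rewrite lee_fin -sumrB mulr_suml; apply: ler_sum => k _; rewrite -mulrBr ler_wpM2l//.
have N1 : 0 < N%:R :> R by rewrite ltr0n.
move: hQ; rewrite ler_pdivlMr ?mulr_gt0// -/ad; move: (N%:R : R) N1 => n n0.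
nra.
Qed.

End core.

(** * Choice of the frequency and conclusion *)

(** [M] is the integer part of t = D (N/q)^(1/alpha), plus 1; at t itself (D/t)^alpha equals q/N.
    Since N^(1/alpha) >= 1, the rounding is absorbed in [B]. *)
Lemma choose_frequency (R : realType) (alpha q D : R) : 0 < alpha -> 0 < q -> 0 < D ->
  exists2 B : R, 0 < B & forall N : nat, (0 < N)%N -> exists2 M : nat, (0 < M)%N &
    (D / M%:R) `^ alpha <= q / N%:R /\ M%:R <= B * N%:R `^ alpha^-1.
Proof.
move=> al0 q0 D0; pose p := (q^-1) `^ alpha^-1.
have p0 : 0 < p by rewrite powR_gt0// invr_gt0.
exists (D * p + 1) => [|N N0]; first by rewrite addr_gt0// mulr_gt0.
have n0 : 0 < N%:R :> R by rewrite ltr0n.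
pose n' := N%:R `^ alpha^-1 : R; have n'0 : 0 < n' by rewrite powR_gt0.
have n'1 : 1 <= n'.
  by rewrite /n' -[leLHS](powRr0 (N%:R : R)) ler_powR ?ler1n// invr_ge0 ltW.
pose t := D * p * n'; have t0 : 0 < t by rewrite !mulr_gt0.
have /andP[h1 h2] := truncn_itv (ltW t0).
exists (Num.trunc t).+1; first by []. 
split; last first.
  rewrite -natr1 mulrDl mul1r -/n' -/t; lra.
have M0 : 0 < (Num.trunc t).+1%:R :> R by rewrite ltr0n.
apply: (@le_trans _ _ ((D / t) `^ alpha)).
  rewrite ge0_ler_powR ?nnegrE ?(ltW al0)// ?divr_ge0 ?(ltW t0) ?(ltW D0)//.
  by rewrite ler_wpM2l ?(ltW D0)// lef_pV2 ?posrE// ltW.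
have -> : D / t = (p * n')^-1.
  by rewrite /t -mulrA invfM mulrA divff ?mul1r// lt0r_neq0.
rewrite /p /n' -powRM ?invr_ge0 ?(ltW q0) ?(ltW n0)//.
rewrite -[X in X `^ alpha <= _]powR_inv1 ?powR_ge0// -!powRrM mulN1r mulrN mulVf ?lt0r_neq0//.
rewrite powRN powRr1 ?mulr_ge0 ?invr_ge0 ?(ltW q0) ?(ltW n0)//.
by rewrite invfM invrK.
Qed.

(** Each of the M frequencies is below 2 M. *)
Lemma sum_freq_ge (R : realType) (M : nat) : (0 < M)%N ->
  (4 * pi * M%:R)^-1 <= \sum_(k < M) (pi * freq R k ^+ 2)^-1.
Proof.
move=> M0; have M0' : 0 < M%:R :> R by rewrite ltr0n.
have pi0 := pi_gt0 R.
apply: (@le_trans _ _ (\sum_(k < M) (pi * (2 * M%:R) ^+ 2)^-1)).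
  rewrite sumr_const card_ord le_eqVlt; apply/orP; left; apply/eqP; rewrite -[RHS]mulr_natl.
  move: (@pi R) (M%:R : R) (lt0r_neq0 pi0) (lt0r_neq0 M0') => w m w0 m0.
  by field; rewrite w0 m0.
apply: ler_sum => k _; have f0 := freq_gt0 R M0 k.
rewrite lef_pV2 ?posrE ?mulr_gt0 ?exprn_gt0// ?mulr_gt0//.
rewrite ler_pM2l// lerXn2r// ?nnegrE ?(ltW f0) ?mulr_ge0//.
by rewrite -natrM ler_nat mul2n -addnn leq_add2l ltnW.
Qed.

(** * Positivity and finiteness of the volume of the unit ball *)

Section unit_ball.
Context (R : realType) (d : nat).

Let in_ball (x : nat -> R) : \bar R := if enorm (vec d x) < 1 then 1%E else 0%E.

Lemma nmeas_in_ball : nmeas in_ball.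
Proof.
move=> dU U x mx; apply: measurable_fun_ifT => //.
apply: measurable_fun_ltr => //; apply: measurable_enorm => i; exact: measurable_vec.
Qed.

(** Positive volume makes the normalisation of the sphere average meaningful, inverse and [fine]
    being total functions; the window is a minorant with known integral. *)
Lemma ball_volume_ge (r0 : R) : (0 < d)%N -> 0 < r0 ->
  (((2 * d%:R * (1 + r0))^-1 ^+ d)%:E <= iint d in_ball)%E.
Proof.
move=> d0 r00; rewrite -(iint_window d0 r00); apply: le_iint => //.
- by move=> x; rewrite lee_fin window_ge0.
- by apply: nmeas_prod; exact: measurable_tri.
- exact: nmeas_in_ball.
move=> x; rewrite /in_ball; have [->|wx] := eqVneq (window d r0 x) 0.
  by case: ifP => _; rewrite lee_fin.
by have [-> _] := window_supp d0 r00 wx; rewrite lee_fin window_le1.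
Qed.

Lemma ball_volume_le : (iint d in_ball <= (4 ^+ d)%:E)%E.
Proof.
have two0 : 0 < 2 :> R by [].
(* The triangle of height 2 and half-width 2 is at least 1 on [-1, 1] and has integral 4. *)
rewrite -(iint_prod d (w := fun t => 2 * tri 2 t)); last 3 first.
- by apply: measurable_funM => //; exact: measurable_tri.
- by move=> t; rewrite mulr_ge0// tri_ge0.
- under eq_integral do rewrite EFinM.
  rewrite ge0_integralZl_EFin//; last 2 first.
  + by move=> t _; rewrite lee_fin tri_ge0.
  + apply/measurable_EFinP; exact: measurable_tri.
  by rewrite (integral_tri two0) fejer0 -EFinM -natrM.
apply: le_iint.
- by move=> x; rewrite /in_ball; case: ifP.
- exact: nmeas_in_ball.
- apply: (nmeas_prod d (w := fun t => 2 * tri 2 t)).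
  by apply: measurable_funM => //; exact: measurable_tri.
move=> x; rewrite /in_ball; case: ifP => h; rewrite lee_fin; last first.
  by apply: prodr_ge0 => i _; rewrite mulr_ge0// tri_ge0.
apply: (big_ind (fun r : R => 1 <= r)) => // [u v|i _]; first exact: mulr_ege1.
have := le_lt_trans (coord_le_enorm (vec d x) i) h; rewrite mxE => xi.
rewrite mulrC -ler_pdivrMr// mul1r /tri le_max; apply/orP; right; lra.
Qed.

End unit_ball.

Section as_probability.
Context d (T : measurableType d) (R : realType) (mu : {measure set T -> \bar R}).

(** The proof of total mass 1 is an argument so that a probability structure can be attached to the
    measure. *)
Definition as_probability (_ : mu setT = 1%E) : set T -> \bar R := mu.

Hypothesis mu1 : mu setT = 1%E.
Let m := as_probability mu1.

Let m0 : m set0 = 0%E. Proof. exact: measure0. Qed.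
Let m_ge0 A : (0 <= m A)%E. Proof. exact: measure_ge0. Qed.
Let m_sigma_additive : semi_sigma_additive m.
Proof. exact: measure_semi_sigma_additive. Qed.

HB.instance Definition _ := isMeasure.Build _ _ _ (as_probability mu1)
  m0 m_ge0 m_sigma_additive.
HB.instance Definition _ := Measure_isProbability.Build _ _ _ (as_probability mu1) mu1.

End as_probability.

Theorem theorem5 (R : realType) (d : nat) (mu : {measure set (borelRd R d) -> \bar R})
  (alpha c0 r0 : R) :
  (2 <= d)%N ->
  mu (msupport mu) = 1%E ->
  0 < alpha -> alpha <= d%:R -> 0 < c0 ->
  (forall (x : 'rV[R]_d) (r : R), 0 < r -> (mu (eball x r) <= (c0 * r `^ alpha)%:E)%E) ->
  msupport mu `<=` eball 0 r0 ->
  exists c : R, 0 < c /\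
    forall (N : nat) (z : 'I_N -> 'rV[R]_d), (0 < N)%N ->
      (forall j, z j \in eball 0 r0) ->
      ((c * N%:R `^ (2^-1 - (2 * alpha)^-1))%:E <= (L2discr mu z) `^ 2^-1)%E.
Proof.
move=> d2 mu1 al0 _ c00 ball sub.
have d0 : (0 < d)%N by exact: ltnW.
have r00 := radius_gt0 mu1 sub.
pose P : probability (borelRd R d) R := as_probability (mu_setT mu1).
(* Truncation to 0 outside the ball gives a bound valid at every point, not just almost everywhere;
   [YE] shows that measures are unaffected. *)
pose Y (y : borelRd R d) : 'rV[R]_d := if enorm (y : 'rV[R]_d) < r0 then y else 0.
have mY i : measurable_fun setT (fun y => Y y ord0 i).
  have -> : (fun y => Y y ord0 i) =
      fun y => if enorm (y : 'rV[R]_d) < r0 then (y : 'rV[R]_d) ord0 i else 0.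
    by apply/funext => y; rewrite /Y; case: ifP; rewrite ?mxE.
  apply: measurable_fun_ifT => //; last exact: measurable_coord.
  by apply: measurable_fun_ltr => //; apply: measurable_enorm => ?; exact: measurable_coord.
have Yr y : enorm (Y y) < r0.
  rewrite /Y; case: ifP => // _; rewrite (_ : enorm 0 = 0)//.
  by rewrite /enorm /dotp big1 ?sqrtr0// => i _; rewrite mxE mul0r.
have YE (F : 'rV[R]_d -> Prop) : measurable ([set y | F y] : set (borelRd R d)) ->
    measurable ([set y | F (Y y)] : set (borelRd R d)) ->
    mu [set y | F y] = P [set y | F (Y y)].
  move=> m1 m2; rewrite -[RHS]/(mu [set y | F (Y y)]).
  apply: (eq_mu_eball sub) => //.
  by apply/seteqP; split => y /= [Fy]; rewrite /eball/= subr0 => yr; split => //;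
    move: Fy; rewrite /Y yr.
have ball' (x : 'rV[R]_d) (rho : R) : 0 < rho ->
    (P [set y | (enorm (Y y - x) < rho)%R] <= (c0 * rho `^ alpha)%:E)%E.
  move=> rho0; rewrite -(YE (fun y => enorm (y - x) < rho)); first exact: ball.
    exact: measurable_eball.
  rewrite -[X in measurable X]setTI.
  rewrite (_ : [set y | _] = (fun y => enorm (Y y - x)) @^-1` `]-oo, rho[).
    apply: measurable_enorm => // i; under eq_fun do rewrite !mxE.
    exact: measurable_funB.
  by apply/seteqP; split => y /=; rewrite in_itv.
pose a : R := (2 * d%:R * (1 + r0))^-1.
have a0 : 0 < a by rewrite invr_gt0 !mulr_gt0 ?ltr0n// addr_gt0.
pose C : R := (4 * (2 * a + 8 / a)) ^+ d.
have C0 : 0 < C.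
  apply: exprn_gt0; apply: mulr_gt0 => //.
  by apply: addr_gt0; [exact: mulr_gt0|exact: divr_gt0].
(* Chosen so that C c0 (q/N) = a^d/(4 N), the threshold of [total_lower]. *)
pose q : R := a ^+ d / (4 * C * c0).
have q0 : 0 < q by apply: divr_gt0; [exact: exprn_gt0|rewrite !mulr_gt0].
have [B B0 hB] := choose_frequency al0 q0 (ltr0Sn R d).
pose vol := intRd (fun x : 'rV[R]_d => if (enorm x < 1)%R then 1%E else 0%E).
have vol0 : 0 < fine vol.
  apply: fine_gt0; apply/andP; split.
    by apply: lt_le_trans (ball_volume_ge d0 r00); rewrite lte_fin exprn_gt0.
  by apply: le_lt_trans (ball_volume_le R d) _; exact: ltry.
(* The 16 pi B collects 4 pi B from the sum over frequencies, 2 from [total_lower] and 2 from the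
   two equal directional integrals; the volume comes from the normalised surface measure. *)
pose K : R := a ^+ d / (16 * pi * B) * (fine vol)^-1.
have K0 : 0 < K.
  apply: mulr_gt0; last by rewrite invr_gt0.
  by apply: divr_gt0; [exact: exprn_gt0|rewrite !mulr_gt0 ?pi_gt0].
exists (K `^ 2^-1); split; first exact: powR_gt0.
move=> N z N0 zr.
have zr' j : enorm (z j) < r0.
  by have := zr j; rewrite inE /eball/= subr0.
have [M M0 [hM1 hM2]] := hB N N0.
have low := total_lower d0 r00 c00 al0 mY Yr ball' N0 zr' M0.
have discE rho v : 0 <= rho ->
    discr mu z rho ((enorm v)^-1 *: v) = rdisc P Y z (enorm v * rho) v.
  move=> rho0.
  have e u : (rho < dotp u ((enorm v)^-1 *: v)) = (enorm v * rho < dotp u v).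
    have -> : dotp u ((enorm v)^-1 *: v) = (enorm v)^-1 * dotp u v.
      by rewrite /dotp mulr_sumr; apply: eq_bigr => i _; rewrite mxE mulrCA.
    (* Homogeneity fails to be a division only at [v = 0], where both comparisons are false because
       [rho] is nonnegative. *)
    have := enorm_ge0 v; rewrite le_eqVlt => /predU1P[v0|v0].
      have /eqP -> : dotp u v == 0.
        by rewrite -normr_le0 (le_trans (normr_dotp _ _))// -v0 mulr0.
      by rewrite -v0 mulr0 mul0r ltxx ltNge rho0.
    by rewrite ltr_pdivlMl.
  rewrite /discr /rdisc /hdisc; congr (_ - _ * fine _).
    by apply: eq_bigr => j _; rewrite e.
  rewrite -(YE (fun y => enorm v * rho < dotp y v)).
  - by congr (mu _); apply/seteqP; split => y /=; rewrite /halfspace/= e.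
  - exact: (measurable_halfspace (enorm v * rho) v).
  rewrite -[X in measurable X]setTI.
  rewrite (_ : [set y | _] = (fun y => dotp (Y y) v) @^-1` `]enorm v * rho, +oo[).
    exact: measurable_dotp.
  by apply/seteqP; split => y /=; rewrite in_itv/= andbT.
have L2E : L2discr mu z = (iint d (dirdisc P Y z) * ((fine vol)^-1)%:E)%E.
  have v0 : (0 <= ((fine vol)^-1)%:E)%E by rewrite lee_fin invr_ge0 ltW.
  rewrite /dirdisc -iint_swap; [|exact: sqdisc_ge0|exact: jmeas_sqdisc].
  rewrite -ge0_integralZr//; last 2 first.
  - by apply: measurable_iint; [exact: sqdisc_ge0|exact: jmeas_sqdisc].
  - by move=> rho _; apply: iint_ge0 => x; exact: sqdisc_ge0.
  rewrite /L2discr [LHS]integral_mkcond; apply: eq_integral => rho _; rewrite patchE.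
  case: ifP => [|/negbT]; rewrite ?inE ?notin_setE/= => rho0.
    congr (_ * _)%E; apply: eq_iint => x.
    by rewrite /sqdisc rho0/= -/(vec d x); case: ifP => // _; rewrite discE.
  rewrite (@eq_iint _ _ _ (fun=> 0%E)) ?iint0 ?mul0e// => x.
  by rewrite /sqdisc (negbTE (introN idP rho0)).
have n0 : 0 < N%:R :> R by rewrite ltr0n.
have IK : ((a ^+ d / (16 * pi * B) * N%:R `^ (1 - alpha^-1))%:E <= iint d (dirdisc P Y z))%E.
  pose S := \sum_(k < M) (pi * freq R k ^+ 2)^-1.
  have n'0 : 0 < N%:R `^ alpha^-1 by rewrite powR_gt0.
  have M0' : 0 < M%:R :> R by rewrite ltr0n.
  apply: (@le_trans _ _ (S * (N%:R * a ^+ d / 4))%:E).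
    rewrite lee_fin.
    apply: (@le_trans _ _ ((4 * pi * (B * N%:R `^ alpha^-1))^-1 * (N%:R * a ^+ d / 4))).
      rewrite powRB ?lt0r_neq0 ?implybT// powRr1 ?(ltW n0)//.
      rewrite le_eqVlt; apply/orP; left; apply/eqP.
      have pi0 := pi_gt0 R.
      move: (@pi R) (N%:R `^ alpha^-1) (a ^+ d) (lt0r_neq0 pi0) (lt0r_neq0 n'0) (lt0r_neq0 B0)
        => w n' ad w0 n'1 B1.
      by field; rewrite B1 n'1 w0.
    rewrite ler_wpM2r ?divr_ge0 ?mulr_ge0 ?exprn_ge0 ?(ltW a0)//.
    apply: le_trans (sum_freq_ge R M0).
    by rewrite lef_pV2 ?posrE ?mulr_gt0 ?pi_gt0// ler_pM2l// mulr_gt0 ?pi_gt0.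
  have {}low : (((S * (N%:R * a ^+ d / 2)))%:E <=
      iint d (dirdisc P Y z) + iint d (dirdisc P Y z))%E.
    apply: low; rewrite -/a -/C.
    have -> : a ^+ d / (4 * N%:R) = C * (c0 * (q / N%:R)).
      rewrite /q; have := lt0r_neq0 C0; have := lt0r_neq0 c00; have := lt0r_neq0 n0.
      move: (a ^+ d) (C) (N%:R : R) => ad C' n n1 c01 C1.
      by field; rewrite n1 c01 C1.
    by rewrite ler_wpM2l ?(ltW C0)// ler_wpM2l ?(ltW c00).
  have J0 : (0 <= iint d (dirdisc P Y z))%E by apply: iint_ge0 => x; exact: dirdisc_ge0.
  (* An infinite directional integral makes the bound trivial; a finite one can be halved as a
     real. *)
  move: low J0; case: (iint d _) => [j low _|_ _|_]; [|exact: leey|by []].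
  by move: low; rewrite -EFinD !lee_fin; move: (S) => S'; lra.
have -> : K `^ 2^-1 * N%:R `^ (2^-1 - (2 * alpha)^-1) =
    (K * N%:R `^ (1 - alpha^-1)) `^ 2^-1.
  rewrite powRM ?powR_ge0 ?(ltW K0)// -powRrM; congr (_ * _ `^ _).
  by rewrite mulrBl mul1r invfM mulrC.
rewrite -poweR_EFin gt0_ler_poweR//; last 3 first.
- by rewrite in_itv/= leey andbT lee_fin mulr_ge0 ?powR_ge0// ltW.
- rewrite in_itv/= leey andbT L2E mule_ge0// ?lee_fin ?invr_ge0 ?(ltW vol0)//.
  apply: iint_ge0 => x; exact: dirdisc_ge0.
by rewrite L2E /K mulrAC EFinM lee_wpmul2r// lee_fin invr_ge0 ltW.
Qed.
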